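(* Consider instances consisting of: a dimension $d\ge1$; the transition probabilities $p(\Lambda,\Delta)$, $\Lambda\subset\{1,\dots,d\}$, $\Delta\in\{-1,0,1\}^d$, of an irreducible constrained homogeneous random walk in $\mathcal{Z}_+^d$; a vector $w\in\Re_+^d$ such that for some $\gamma>0$ and every nonempty $\Lambda\subset\{1,\dots,d\}$ $$\sum_{\Delta\in\{-1,0,1\}^d}(w^T\Delta)\,p(\Lambda,\Delta)\le-\gamma;$$ a rational number $0\le r\le1$; and a vector $v\in\mathcal{Z}_+^d$. Let $\pi$ be the unique stationary distribution of the walk and $$L_-(v)=\liminf_{n\to\infty}\frac{-\log \pi(vn)}{n},\qquad L_+(v)=\limsup_{n\to\infty}\frac{-\log \pi(vn)}{n}.$$ Then each of the following two decision problems is algorithmically undecidable (no algorithm solves it correctly on all such instances): determine whether $L_-(v)\le r$; determine whether $L_+(v)\le r$.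
   Context: $\mathcal{Z}_+^d$ is the set of $d$-dimensional vectors with nonnegative integer components, and $\Re_+$ is the set of nonnegative reals. For $\Lambda\subset\{1,\dots,d\}$ the corresponding face is $\mathcal{Z}_\Lambda=\{z\in\mathcal{Z}_+^d: z_i>0 \text{ for } i\in\Lambda,\ z_i=0\text{ for } i\notin\Lambda\}$. A constrained homogeneous random walk in $\mathcal{Z}_+^d$ is a Markov chain $Q(t)$, $t=0,1,2,\dots$, with state space $\mathcal{Z}_+^d$ specified by finitely many numbers $p(\Lambda,\Delta)\ge 0$ ($\Lambda\subset\{1,\dots,d\}$, $\Delta\in\{-1,0,1\}^d$) such that $\sum_{\Delta}p(\Lambda,\Delta)=1$ for every $\Lambda$, and $p(\Lambda,\Delta)=0$ whenever $\Delta_i=-1$ for some $i\notin\Lambda$. If $Q(t)\in\mathcal{Z}_\Lambda$, then $Q(t+1)=Q(t)+\Delta$ with probability $p(\Lambda,\Delta)$. Let $p^{(t)}(q,q')$ denote the $t$-step transition probabilities. Convention on irreducibility: it is assumed that every state $q$ satisfies $p^{(t)}(q,0)>0$ for some $t\ge 0$; this is what ''irreducible'' means here. The displayed condition on $w$ says that $\Phi(q)=w^Tq$ is a linear Lyapunov function; under it the walk is positive recurrent and has a unique stationary distribution $\pi$, i.e. a probability distribution on $\mathcal{Z}_+^d$ with $\sum_{q'}\pi(q')p(q',q)=\pi(q)$ for all $q$, where $p(q,q')=p(\Lambda,q'-q)$ for $q\in\mathcal{Z}_\Lambda$. $-\log 0=+\infty$, so $L_\pm(v)\in[0,+\infty]$.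 Instances are finite data: the numbers $p(\Lambda,\Delta)$ and the entries of $w$ are rational numbers given explicitly. *)

(* Defs.v *)
(* MathComp with MathComp-Analysis *)
From mathcomp Require Import all_boot all_order all_algebra.
From mathcomp Require Import boolp classical_sets functions reals ereal.
From mathcomp Require Import sequences exp esum.

Set Implicit Arguments.
Unset Strict Implicit.
Unset Printing Implicit Defensive.

Import Order.TTheory GRing.Theory Num.Theory.

Local Open Scope classical_set_scope.
Local Open Scope ring_scope.

(** * Algorithms: partial recursive functions on nat *)

Inductive recfun : nat -> Type :=
| RZero n : recfun n
| RSucc : recfun 1
| RProj n of 'I_n : recfun n
| RComp n k of recfun k & ('I_k -> recfun n) : recfun n
| RPrec n of recfun n & recfun n.+2 : recfun n.+1
| RMu n of recfun n.+1 : recfun n.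

(* [computes f x y]: f is defined at x, with value y.  In [RPrec g h] the
   recursion is on the first argument, with
   f (0, x) = g x and f (m+1, x) = h (m, f (m, x), x);
   [RMu g] is unbounded search on the first argument of g. *)
Fixpoint computes n (f : recfun n) : n.-tuple nat -> nat -> Prop :=
  match f in recfun n return n.-tuple nat -> nat -> Prop with
  | RZero _ => fun _ y => y = 0%N
  | RSucc => fun x y => y = (thead x).+1
  | RProj _ i => fun x y => y = tnth x i
  | RComp _ k g h => fun x y =>
      exists2 z : k.-tuple nat,
        (forall i, computes (h i) x (tnth z i)) & computes g z y
  | RPrec _ g h => fun x y =>
      exists s : nat -> nat,
        [/\ computes g [tuple of behead x] (s 0%N),
            (forall m, (m < thead x)%N ->
               computes h [tuple of m :: s m :: behead x] (s m.+1))
          & y = s (thead x)]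
  | RMu _ g => fun x y =>
      computes g [tuple of y :: x] 0%N /\
      (forall m, (m < y)%N ->
         exists k, computes g [tuple of m :: x] k.+1)
  end.

Lemma computes_fun n (f : recfun n) (x : n.-tuple nat) (y y' : nat) :
  computes f x y -> computes f x y' -> y = y'.
Proof.
elim: f x y y' => {n} [n|| n i | n k g IHg h IHh | n g IHg h IHh | n g IHg] x y y' /=.
- by move=> -> ->.
- by move=> -> ->.
- by move=> -> ->.
- move=> [z hz gz] [z' hz' gz']; suff E : z = z' by apply: IHg gz _; rewrite E.
  by apply: eq_from_tnth => i; exact: IHh (hz i) (hz' i).
- move=> [s [s0 ss ->]] [s' [s0' ss' ->]].
  suff : forall m, (m <= thead x)%N -> s m = s' m by apply.
  elim=> [_|m IHm lt_m]; first exact: IHg s0 s0'.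
  have := ss' _ lt_m; rewrite -IHm 1?ltnW // => H.
  exact: IHh (ss _ lt_m) H.
move=> [y0 ym] [y'0 y'm]; apply/eqP; rewrite eqn_leq.
apply/andP; split; rewrite leqNgt; apply/negP.
  by move=> /ym [k /(IHg _ _ _ y'0)].
by move=> /y'm [k /(IHg _ _ _ y0)].
Qed.

(* [P] is a decision problem with promise [D] on data of type [T], presented to
   the algorithm through [code]; nothing is required of the algorithm (not even
   termination) outside of [D]. *)
Definition decidable_on (T : Type) (code : T -> nat) (D P : T -> Prop) : Prop :=
  exists f : recfun 1, forall x : T, D x ->
    (P x -> computes f [tuple code x] 1%N) /\
    (~ P x -> computes f [tuple code x] 0%N).

(** * Constrained homogeneous random walks *)

Notation state d := {ffun 'I_d -> nat}.

(* An element of {-1,0,1}^d: the ordinal j stands for j - 1. *)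
Notation move d := {ffun 'I_d -> 'I_3}.

Definition disp d (D : move d) (i : 'I_d) : int := (D i : nat)%:Z - 1.

Definition face d (q : state d) : {set 'I_d} := [set i | (0 < q i)%N]%SET.

Record instance := Instance {
  dim : nat;
  prob : {ffun {set 'I_dim} * move dim -> rat};
  weight : {ffun 'I_dim -> rat};
  rate : rat;
  dir : state dim
}.

Section Walk.
Variables (R : realType) (I : instance).
Let d := dim I.

(* At most one move leads from q to q'. *)
Definition trans (q q' : state d) : R :=
  \sum_(D : move d | [forall i, (q' i)%:Z == (q i)%:Z + disp D i])
     ratr (prob I (face q, D)).

Fixpoint ntrans (t : nat) (q q' : state d) : \bar R :=
  if t is s.+1 then
    \esum_(q1 in [set: state d]) ((trans q q1)%:E * ntrans s q1 q')%E
  else ((q == q')%:R)%:E.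

Definition irreducible : Prop :=
  forall q : state d, exists t : nat, (0 < ntrans t q 0%R)%E.

Definition is_walk : Prop :=
  [/\ forall (L : {set 'I_d}) (D : move d), 0 <= prob I (L, D),
      forall L : {set 'I_d}, \sum_(D : move d) prob I (L, D) = 1
    & forall (L : {set 'I_d}) (D : move d) (i : 'I_d),
        i \notin L -> disp D i = -1 -> prob I (L, D) = 0].

Definition drift (L : {set 'I_d}) : rat :=
  \sum_(D : move d) (\sum_i weight I i * (disp D i)%:~R) * prob I (L, D).

Definition is_lyapunov : Prop :=
  (forall i, 0 <= weight I i) /\
  exists2 gamma : R, 0 < gamma
    & forall L : {set 'I_d}, L != finset.set0 -> ratr (drift L) <= - gamma.

Definition valid_instance : Prop :=
  [/\ (1 <= d)%N, is_walk, irreducible, is_lyapunov & 0 <= rate I <= 1].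

Definition is_stationary (pi : state d -> R) : Prop :=
  [/\ forall q, 0 <= pi q,
      \esum_(q in [set: state d]) (pi q)%:E = 1%E
    & forall q, \esum_(q' in [set: state d]) (pi q' * trans q' q)%:E
                = (pi q)%:E].

(* For a valid instance there is exactly one stationary distribution; the
   default value 0 is irrelevant then. *)
Definition stationary : state d -> R :=
  xget (fun=> 0) [set pi | is_stationary pi].

(* - log (pi (v n)) / n; note that [lne 0 = -oo]. *)
Definition log_rate (n : nat) : \bar R :=
  (- lne (stationary (dir I *+ n))%:E * (n%:R^-1)%:E)%E.

Definition L_minus : \bar R := limn_einf log_rate.
Definition L_plus : \bar R := limn_esup log_rate.

Definition L_minus_le_rate : Prop := (L_minus <= (ratr (rate I))%:E)%E.
Definition L_plus_le_rate : Prop := (L_plus <= (ratr (rate I))%:E)%E.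

End Walk.

(** * Presentation of instances to algorithms *)

(* The subsets and moves are listed by increasing binary, resp. ternary,
   numerals, coordinate i being the digit of weight 2^i, resp. 3^i. *)
Definition nth_face d (k : nat) : {set 'I_d} :=
  [set i : 'I_d | odd (k %/ 2 ^ i)]%SET.
Definition nth_move d (k : nat) : move d :=
  [ffun i : 'I_d => inord (k %/ 3 ^ i %% 3)].

Definition encode_rat (x : rat) : seq nat :=
  [:: nat_of_bool (x < 0)%R; `|numq x|%N; `|denq x|%N].

Definition instance_data (I : instance) : seq nat :=
  dim I ::
  flatten [seq encode_rat (prob I (nth_face _ k, nth_move _ l))
             | k <- iota 0 (2 ^ dim I), l <- iota 0 (3 ^ dim I)] ++
  flatten [seq encode_rat (weight I i) | i <- enum 'I_(dim I)] ++
  encode_rat (rate I) ++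
  [seq dir I i | i <- enum 'I_(dim I)].

Definition encode (I : instance) : nat := CodeSeq.code (instance_data I).

Lemma encode_rat_inj : injective encode_rat.
Proof.
move=> x y [sg n dd]; rewrite -(divq_num_den x) -(divq_num_den y).
have -> : denq x = denq y.
  by rewrite -(gtz0_abs (denq_gt0 x)) dd gtz0_abs ?denq_gt0.
congr (_ %:~R / _); rewrite (intEsign (numq x)) (intEsign (numq y)) n.
by rewrite !numq_lt0; case: (x < 0) (y < 0) sg => [] [].
Qed.

Lemma digit_sum (b d : nat) (a : 'I_d -> nat) (i : 'I_d) :
  (forall j, a j < b)%N ->
  (((\sum_j a j * b ^ j) < b ^ d) /\
   (\sum_j a j * b ^ j) %/ b ^ i %% b = a i)%N.
Proof.
elim: d a i => [|d IHd] a i ab; first by case: i.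
have b0 : (0 < b)%N by apply: leq_ltn_trans (ab i).
have [E lt] : (\sum_j a j * b ^ j = a ord0 + b * \sum_(j < d) a (lift ord0 j) * b ^ j)%N
  /\ (\sum_(j < d) a (lift ord0 j) * b ^ j < b ^ d)%N.
  split; last first.
    by case: d IHd a i ab => [|d] IHd a i ab; [rewrite big_ord0|case: (IHd (fun j => a (lift ord0 j)) ord0)].
  rewrite big_ord_recl /= expn0 muln1 big_distrr /=; congr (_ + _)%N.
  by apply: eq_bigr => j _; rewrite /bump /= add1n expnS mulnCA.
rewrite E; set s := (\sum_(j < d) _)%N in lt *; split.
  apply: (@leq_trans (b * s.+1)%N); first by rewrite mulnS ltn_add2r.
  by rewrite expnS leq_mul2l lt orbT.
case: (unliftP ord0 i) => [j|] ->.
  rewrite /= /bump /= add1n expnS divnMA (mulnC b s) addnC divnMDl //.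
  rewrite (divn_small (ab _)) addn0.
  by have [] := IHd (fun j => a (lift ord0 j)) j (fun j => ab _).
by rewrite expn0 divn1 (mulnC b s) addnC modnMDl modn_small.
Qed.

Lemma nth_face_surj d (L : {set 'I_d}) :
  exists2 k, (k < 2 ^ d)%N & nth_face d k = L.
Proof.
case: d L => [|d] L.
  by exists 0%N => //; apply/setP => -[].
have lt2 (j : 'I_d.+1) : ((j \in L : nat) < 2)%N by case: (j \in L).
exists (\sum_(j < d.+1) (j \in L) * 2 ^ j)%N.
  by have [] := digit_sum ord0 lt2.
apply/setP => i; rewrite inE -[RHS]oddb.
by have [_ <-] := digit_sum i lt2; rewrite modn2 oddb.
Qed.

Lemma nth_move_surj d (D : move d) :
  exists2 k, (k < 3 ^ d)%N & nth_move d k = D.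
Proof.
case: d D => [|d] D.
  by exists 0%N => //; apply/ffunP => -[].
have lt3 (j : 'I_d.+1) : (D j < 3)%N by [].
exists (\sum_(j < d.+1) D j * 3 ^ j)%N.
  by have [] := digit_sum ord0 lt3.
apply/ffunP => i; rewrite ffunE; apply: val_inj.
by rewrite /= inordK ?ltn_pmod //; have [_ ->] := digit_sum i lt3.
Qed.

Lemma flatten_encode_rat_inj (T : eqType) (s : seq T) (f g : T -> rat) u v :
  flatten [seq encode_rat (f x) | x <- s] ++ u =
  flatten [seq encode_rat (g x) | x <- s] ++ v ->
  {in s, f =1 g} /\ u = v.
Proof.
elim: s => [//|x s IHs] /=.
move=> [a b c /IHs [fg ->]]; split=> // y; rewrite inE => /predU1P[->|/fg//].
by apply: encode_rat_inj; rewrite /encode_rat a b c.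
Qed.

Lemma encode_inj : injective encode.
Proof.
move=> I J /(can_inj CodeSeq.codeK).
case: I J => [d p w r v] [d' p' w' r' v'].
rewrite /instance_data /= => -[E]; case: d' / E p' w' v' => p' w' v' /=.
have E (q : {ffun {set 'I_d} * move d -> rat}) :
  [seq encode_rat (q (nth_face _ k, nth_move _ l))
     | k <- iota 0 (2 ^ d), l <- iota 0 (3 ^ d)] =
  [seq encode_rat (q (nth_face _ x.1, nth_move _ x.2))
     | x <- [seq (k, l) | k <- iota 0 (2 ^ d), l <- iota 0 (3 ^ d)]].
  by rewrite map_allpairs.
rewrite !E => /flatten_encode_rat_inj[pp] /flatten_encode_rat_inj[ww].
move=> [a b c vv].
have -> : r = r' by apply: encode_rat_inj; rewrite /encode_rat a b c.
have -> : w = w' by apply/ffunP => i; apply: ww; rewrite mem_enum.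
have -> : v = v'.
  by apply/ffunP => i; move/eq_in_map: vv; apply; rewrite mem_enum.
suff -> : p = p' by [].
apply/ffunP => -[L D].
have [k ltk <-] := nth_face_surj L; have [l ltl <-] := nth_move_surj D.
by apply: (pp (k, l)); apply/allpairsP; exists (k, l); rewrite !mem_iota.
Qed.

(* Main.v *)
Require Import Defs.
From mathcomp Require Import all_boot all_order all_algebra.
From mathcomp Require Import boolp classical_sets fsbigop.
From mathcomp Require Import reals ereal topology normedtype sequences exp esum.
From mathcomp Require Import zify ring lra.

Set Implicit Arguments.
Unset Strict Implicit.
Unset Printing Implicit Defensive.

Import Order.TTheory GRing.Theory Num.Theory.

Local Open Scope nat_scope.

(** Why the theorem holds.  The chain attached to a counter machine has only two
possible moves from every state.  With probability 5/9 it drains, lowering every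
positive coordinate by one; with probability 4/9 it performs one step of the
machine.  A machine step raises the sum of the coordinates by at most one, so
with weights equal to one the drift is at most 4/9 - 5/9 < 0 on every nonempty
face, whatever the machine does, and the origin is reached from everywhere by
draining.  Nothing is required of the probability of a successful run except
that it be positive: a run of the machine is a path of machine steps from the
origin, and an interrupted run just drains.

The coordinates below [K] are registers, the others are program positions, one of
them equal to 1 at a time.  Register 1 is never touched by the program; a unit is
put there when the machine halts.  On states that consist of registers only, a
machine step raises the last positive register.  Let [v] be the unit vector of
register 1.
- If the machine halts with empty registers, [v] is reached and then [v n] is
  reached by [n - 1] further steps of probability 4/9.  Hence
  pi(v n) >= c (4/9)^n, and both rates are at most ln (9/4) < 1
  ([rate_reachable]).
- If the machine runs forever, the states of its run, together with the states made
  of registers only in which register 1 is empty, form a closed set that contains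
  the origin.  A stationary distribution gives no
  mass to its complement ([invariant_closed]), so pi(v n) = 0 for n >= 1 and both
  rates are infinite ([rate_unreachable]).
With threshold 1 either decision problem is thus the halting problem.

The first case needs a stationary distribution to exist.  It is the normalized
expected number of visits during an excursion from the origin; the linear
function bounds the length of the excursion ([invariant_distribution_exists]).

The undecidability is obtained by a direct diagonal argument, which needs no
universal machine.  The input of a program is a number [k] of extra program
positions, all of them occupied by increments of register 0 and executed before
the program.  The behaviour of the walk of a program on the faces without extra
positions is a finite table; let [s] be its code.  The walk of that program on
input [s] is so regular that its code is a recursive function of [s] alone
([rec1_instance_code], [encode_machine]).  Given a candidate algorithm [f], compile
the program that computes this code from its input, applies [f] to it, loops if
the answer is nonzero and halts if it is zero, and run it on the code [s] of its
own table.  The resulting instance refutes [f] ([diagonal_instance]).  Programs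
are compiled from recursive functions by [compile]. *)

(** * Recursive functions *)

(** Inputs are lists rather than tuples, so that a variable is [nth 0 x i] and binding
a new variable is [cons]; the arity [n] only says how many entries matter. *)
Definition recursive n (F : seq nat -> nat) : Prop :=
  exists f : recfun n, forall x : n.-tuple nat, computes f x (F x).

Lemma eq_recursive_size n F G :
  recursive n F -> (forall x, size x = n -> F x = G x) -> recursive n G.
Proof. by move=> [f fF] FG; exists f => x; rewrite -FG ?size_tuple. Qed.

Lemma eq_recursive n F G : recursive n F -> F =1 G -> recursive n G.
Proof. by move=> [f fF] FG; exists f => x; rewrite -FG. Qed.

Lemma recursive_var n i : recursive n (fun x => nth 0 x i).
Proof.
have [lt_in|le_ni] := ltnP i n; last first.
  by exists (RZero n) => x /=; rewrite nth_default ?size_tuple.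
by exists (RProj (Ordinal lt_in)) => x /=; rewrite (tnth_nth 0).
Qed.

Lemma recursive_comp n k G (H : nat -> seq nat -> nat) :
  recursive k G -> (forall i, i < k -> recursive n (H i)) ->
  recursive n (fun x => G [seq H i x | i <- iota 0 k]).
Proof.
move=> [g gG] rH.
have [h hH] : exists h : 'I_k -> recfun n, forall i x, computes (h i) x (H i x).
  elim: k {g gG} rH => [|k IHk] rH; first by exists (fun=> RZero n) => -[].
  have [|h hH] := IHk; first by move=> i /ltnW; apply: rH.
  have [f fH] := rH k (ltnSn k).
  exists (fun i => if unlift ord_max i is Some j then h j else f) => i x.
  case: unliftP => [j|] -> //=.
  by rewrite /bump leqNgt ltn_ord add0n; apply: hH.
exists (RComp g h) => x /=.
have sz : size [seq H i x | i <- iota 0 k] == k by rewrite size_map size_iota.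
exists (Tuple sz) => [i|]; last exact: (gG (Tuple sz)).
by rewrite (tnth_nth 0) /= (nth_map 0) ?size_iota // nth_iota // add0n.
Qed.

Lemma recursive_env k G n (H : nat -> nat) :
  recursive k G -> recursive n (fun x => G [seq nth 0 x (H i) | i <- iota 0 k]).
Proof. by move=> rG; apply: recursive_comp => // i _; apply: recursive_var. Qed.

(** In the body the counter and the accumulator are the first two variables, which is
why the variables of the context appear two places further. *)
Lemma recursive_iteri n G H T :
  recursive n G ->
  recursive n.+2 (fun y => H (nth 0 y 0) (nth 0 y 1) (behead (behead y))) ->
  recursive n T ->
  recursive n (fun x => iteri (T x) (fun m a => H m a x) (G x)).
Proof.
move=> [g gG] [h hH] rT.
have rR : recursive n.+1 (fun y => iteri (nth 0 y 0)
    (fun m a => H m a (behead y)) (G (behead y))).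
  exists (RPrec g h) => x /=.
  exists (fun j => iteri j (fun m a => H m a (behead x)) (G (behead x))); split.
  - exact: (gG [tuple of behead x]).
  - move=> m lt_m; exact: (hH [tuple of m :: _ :: behead x]).
  - by case/tupleP: x => a x /=; rewrite /thead tnth0.
(* The recursion variable is fed with [T x], the others are passed unchanged. *)
pose H' i x := if i is j.+1 then nth 0 x j else T x.
have [|f fE] := @recursive_comp n n.+1 _ H' rR.
  by case=> [|i] _ //; apply: recursive_var.
exists f => x; move: (fE x) => /=.
suff -> : [seq H' i x | i <- iota 1 n] = x by [].
rewrite (iotaDl 1 0) -map_comp -[RHS](mkseq_nth 0) size_tuple.
exact: eq_map.
Qed.

Definition rec1 g := recursive 1 (fun x => g (nth 0 x 0)).
Definition rec2 g := recursive 2 (fun x => g (nth 0 x 0) (nth 0 x 1)).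
Definition rec3 g := recursive 3 (fun x => g (nth 0 x 0) (nth 0 x 1) (nth 0 x 2)).

Lemma recursive1 g n F :
  rec1 g -> recursive n F -> recursive n (fun x => g (F x)).
Proof. by move=> rg rF; apply: (recursive_comp (H := fun=> F) rg). Qed.

Lemma recursive2 g n F1 F2 : rec2 g -> recursive n F1 -> recursive n F2 ->
  recursive n (fun x => g (F1 x) (F2 x)).
Proof.
move=> rg r1 r2.
by apply: (recursive_comp (H := nth F2 [:: F1]) rg) => -[|[]].
Qed.

Lemma recursive3 g n F1 F2 F3 : rec3 g ->
  recursive n F1 -> recursive n F2 -> recursive n F3 ->
  recursive n (fun x => g (F1 x) (F2 x) (F3 x)).
Proof.
move=> rg r1 r2 r3.
by apply: (recursive_comp (H := nth F3 [:: F1; F2]) rg) => -[|[|[]]].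
Qed.

Lemma rec1_succ : rec1 succn.
Proof. by exists RSucc => x /=; rewrite /thead (tnth_nth 0). Qed.

Lemma recursive_const n c : recursive n (fun=> c).
Proof.
elim: c => [|c IHc]; first by exists (RZero n).
exact: recursive1 rec1_succ IHc.
Qed.

Lemma recursive_var2 n i : recursive n (fun y => nth 0 (behead (behead y)) i).
Proof. by apply: eq_recursive (recursive_var n i.+2) _ => y; rewrite !nth_behead. Qed.

Lemma recursive_if n (b : seq nat -> bool) F G :
  recursive n (fun x => nat_of_bool (b x)) -> recursive n F -> recursive n G ->
  recursive n (fun x => if b x then F x else G x).
Proof.
move=> rb rF rG.
have rif : rec3 (fun c u v => iteri c (fun _ _ => u) v).
  apply: (@recursive_iteri 3 (fun x => nth 0 x 2) (fun _ _ x => nth 0 x 1)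
           (fun x => nth 0 x 0)); by [apply: recursive_var | apply: recursive_var2].
by apply: eq_recursive (recursive3 rif rb rF rG) _ => x; case: (b x).
Qed.

#[local] Create HintDb rec.
#[local] Hint Resolve rec1_succ : rec.

(** Follows the syntax of the function, using the hints of [rec] for the function
symbols. *)
Ltac recsolve := cbv beta;
  lazymatch goal with
  | |- recursive _ (fun x => nth 0 x ?i) => exact: recursive_var
  | |- recursive _ (fun x => nth 0 (behead (behead x)) ?i) => exact: recursive_var2
  | |- recursive _ (fun=> ?c) => exact: recursive_const
  | |- recursive ?n (fun x => iteri (@?T x) (fun m a => @?H x m a) (@?G x)) =>
     refine (@recursive_iteri n G (fun m a x => H x m a) T _ _ _); recsolve
  | |- recursive ?n (fun x => nat_of_bool (?g (@?F1 x) (@?F2 x))) =>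
     refine (@recursive2 (fun a b => nat_of_bool (g a b)) n F1 F2 _ _ _);
       [solve [eauto with rec nocore] | recsolve | recsolve]
  | |- recursive ?n (fun x => nat_of_bool (?g (@?F1 x))) =>
     refine (@recursive1 (fun a => nat_of_bool (g a)) n F1 _ _);
       [solve [eauto with rec nocore] | recsolve]
  | |- recursive ?n (fun x => ?g (@?F1 x) (@?F2 x) (@?F3 x)) =>
     refine (@recursive3 g n F1 F2 F3 _ _ _ _);
       [solve [eauto with rec nocore] | recsolve | recsolve | recsolve]
  | |- recursive ?n (fun x => ?g (@?F1 x) (@?F2 x)) =>
     refine (@recursive2 g n F1 F2 _ _ _); [solve [eauto with rec nocore] | recsolve | recsolve]
  | |- recursive ?n (fun x => ?g (@?F1 x)) =>
     refine (@recursive1 g n F1 _ _); [solve [eauto with rec nocore] | recsolve]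
  | |- _ => apply: recursive_if; recsolve
  end.

Lemma rec2_add : rec2 addn.
Proof.
suff : rec2 (fun a b => iteri b (fun _ u => u.+1) a).
  move/eq_recursive; apply => x; elim: (nth 0 x 1) => [|k /= ->].
    by rewrite addn0.
  by rewrite addnS.
rewrite /rec2; recsolve.
Qed.
#[local] Hint Resolve rec2_add : rec.

Lemma rec2_mul : rec2 muln.
Proof.
suff : rec2 (fun a b => iteri b (fun _ u => u + a) 0).
  move/eq_recursive; apply => x; elim: (nth 0 x 1) => [|k /= ->].
    by rewrite muln0.
  by rewrite mulnS addnC.
rewrite /rec2; recsolve.
Qed.
#[local] Hint Resolve rec2_mul : rec.

Lemma rec2_exp : rec2 expn.
Proof.
suff : rec2 (fun a b => iteri b (fun _ u => u * a) 1).
  by move/eq_recursive; apply => x; elim: (nth 0 x 1) => [|k /= ->] //; rewrite expnSr.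
rewrite /rec2; recsolve.
Qed.
#[local] Hint Resolve rec2_exp : rec.

Lemma rec1_pred : rec1 predn.
Proof.
suff : rec1 (fun a => iteri a (fun m _ => m) 0).
  by move/eq_recursive; apply => x; case: (nth 0 x 0).
rewrite /rec1; recsolve.
Qed.
#[local] Hint Resolve rec1_pred : rec.

Lemma rec2_sub : rec2 subn.
Proof.
suff : rec2 (fun a b => iteri b (fun _ u => u.-1) a).
  move/eq_recursive; apply => x; elim: (nth 0 x 1) => [|k /= ->].
    by rewrite subn0.
  by rewrite subnS.
rewrite /rec2; recsolve.
Qed.
#[local] Hint Resolve rec2_sub : rec.

Lemma rec2_leq : rec2 leq.
Proof.
suff : rec2 (fun a b => 1 - (a - b)).
  by move/eq_recursive; apply => x; rewrite leqNgt; lia.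
rewrite /rec2; recsolve.
Qed.
#[local] Hint Resolve rec2_leq : rec.

Lemma rec2_eq : rec2 (fun a b => nat_of_bool (a == b)).
Proof.
suff : rec2 (fun a b => (a <= b) * (b <= a)).
  by move/eq_recursive; apply => x; rewrite mulnb -eqn_leq.
rewrite /rec2; recsolve.
Qed.
#[local] Hint Resolve rec2_eq : rec.

Lemma recursive_sum n (F : nat -> seq nat -> nat) T :
  recursive n.+2 (fun y => F (nth 0 y 0) (behead (behead y))) -> recursive n T ->
  recursive n (fun x => \sum_(i < T x) F i x).
Proof.
move=> rF rT.
suff : recursive n (fun x => iteri (T x) (fun m a => a + F m x) 0).
  move/eq_recursive; apply => x; elim: (T x) => [|k /= ->]; first by rewrite big_ord0.
  by rewrite big_ord_recr.
apply: (@recursive_iteri n _ (fun m a x => a + F m x) T) => //; first exact: recursive_const.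
apply: (recursive2 rec2_add) => //; exact: recursive_var.
Qed.

Lemma sum_ltn a q : \sum_(i < a) (i < q) = minn a q.
Proof. elim: a => [|a IHa]; first by rewrite big_ord0 min0n. rewrite big_ord_recr /= IHa;
    lia. Qed.

(** The quotient counts the positive multiples of the divisor up to the dividend. *)
Lemma rec2_div : rec2 divn.
Proof.
suff : rec2 (fun a b => (0 < b) * \sum_(i < a) (i.+1 * b <= a)).
  move/eq_recursive; apply => x; move: (nth 0 x 0) (nth 0 x 1) => a b.
  case: b => [|b]; first by rewrite divn0.
  rewrite mul1n (eq_bigr (fun i : 'I_a => nat_of_bool (i < a %/ b.+1))); last first.
    by move=> i _; rewrite leq_divRL.
  by rewrite sum_ltn; apply/minn_idPr; exact: leq_div.
rewrite /rec2; apply: (recursive2 rec2_mul); first by recsolve.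
apply: (@recursive_sum 2 (fun i x => (i.+1 * nth 0 x 1 <= nth 0 x 0)%N)); recsolve.
Qed.
#[local] Hint Resolve rec2_div : rec.

Lemma rec2_mod : rec2 modn.
Proof.
suff : rec2 (fun a b => a - a %/ b * b).
  by move/eq_recursive; apply => x; rewrite {1}(divn_eq (nth 0 x 0) (nth 0 x 1)) addKn.
rewrite /rec2; recsolve.
Qed.
#[local] Hint Resolve rec2_mod : rec.

Lemma rec2_dvd : rec2 dvdn.
Proof. rewrite /rec2 /dvdn; recsolve. Qed.
#[local] Hint Resolve rec2_dvd : rec.

Lemma rec1_odd : rec1 odd.
Proof.
suff : rec1 (fun a => a %% 2) by move/eq_recursive; apply => x; rewrite modn2.
rewrite /rec1; recsolve.
Qed.
#[local] Hint Resolve rec1_odd : rec.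

(** * Compiling recursive functions to counter programs *)

Inductive cmd :=
| Skip
| Inc of nat
| Dec of nat
| Seq of cmd & cmd
| While of nat & cmd.

Definition store := nat -> nat.
Definition upd (u : store) r v : store := fun i => if i == r then v else u i.

(** Only terminating runs have a derivation; a loop is handled later by a cycle of the
chain. *)
Inductive exec : cmd -> store -> store -> Prop :=
| ExecSkip u : exec Skip u u
| ExecInc r u : exec (Inc r) u (upd u r (u r).+1)
| ExecDec r u : exec (Dec r) u (upd u r (u r).-1)
| ExecSeq c1 c2 u v w : exec c1 u v -> exec c2 v w -> exec (Seq c1 c2) u w
| ExecDone r c u : u r = 0 -> exec (While r c) u u
| ExecLoop r c u v w :
    u r != 0 -> exec c u v -> exec (While r c) v w -> exec (While r c) u w.

Ltac store_eq := apply: funext => ?; rewrite /upd;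
  repeat (case: eqP => ?; subst => //=); try lia; try congruence.

Definition clear r := While r (Dec r).
Definition transfer r q := While r (Seq (Dec r) (Inc q)).
Definition copy r q t := Seq (While r (Seq (Dec r) (Seq (Inc q) (Inc t)))) (transfer t r).
Definition seqs := foldr Seq Skip.

Lemma exec_eq c u v w : exec c u v -> v = w -> exec c u w.
Proof. by move=> ? <-. Qed.

Lemma exec_clear r u : exec (clear r) u (upd u r 0).
Proof.
have [k] := ubnP (u r); elim: k u => // k IHk u /ltnSE le_k.
have [u0|u_gt0] := posnP (u r).
  by apply: exec_eq (ExecDone _ u0) _; store_eq.
apply: ExecLoop (ExecDec _ _) _; first by rewrite -lt0n.
apply: exec_eq (IHk _ _) _; last by store_eq.
by rewrite /upd eqxx; lia.
Qed.

Lemma exec_transfer r q u : r != q -> exec (transfer r q) u (upd (upd u q (u q + u r)) r 0).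
Proof.
move=> /eqP rq; have [k] := ubnP (u r); elim: k u => // k IHk u /ltnSE le_k.
have [u0|u_gt0] := posnP (u r).
  by apply: exec_eq (ExecDone _ u0) _; store_eq.
apply: ExecLoop (ExecSeq (ExecDec _ _) (ExecInc _ _)) _; first by rewrite -lt0n.
apply: exec_eq (IHk _ _) _; last by store_eq.
by rewrite /upd eqxx; case: eqP => //; lia.
Qed.

Lemma exec_copy r q t u : uniq [:: r; q; t] -> u t = 0 ->
  exec (copy r q t) u (upd u q (u q + u r)).
Proof.
rewrite /= !inE !negb_or => /and3P[/andP[/eqP rq /eqP rt] /eqP qt _] ut0.
suff H k : u r = k -> exec (While r (Seq (Dec r) (Seq (Inc q) (Inc t)))) u
   (upd (upd (upd u q (u q + k)) r 0) t (u t + k)).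
  apply: ExecSeq (H _ erefl) _.
  by apply: exec_eq (exec_transfer _ _) _; [apply/eqP; congruence | store_eq].
elim: k u {ut0} => [|k IHk] u uk.
  by apply: exec_eq (ExecDone _ uk) _; store_eq.
apply: ExecLoop (ExecSeq (ExecDec _ _) (ExecSeq (ExecInc _ _) (ExecInc _ _))) _.
  by rewrite uk.
apply: exec_eq (IHk _ _) _.
  by rewrite /upd eqxx; do !case: eqP => //; lia.
by store_eq.
Qed.

Lemma exec_seqs k (c : 'I_k -> cmd) (u : nat -> store) :
  (forall i : 'I_k, exec (c i) (u i) (u i.+1)) ->
  exec (seqs [seq c i | i : 'I_k <- enum 'I_k]) (u 0) (u k).
Proof.
elim: k c u => [|k IHk] c u H; first by rewrite enum_ord0; apply: ExecSkip.
rewrite enum_ordSl /= -map_comp; apply: ExecSeq (H ord0) _.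
by apply: (IHk (c \o lift ord0) (u \o succn)) => i; apply: (H (lift ord0 i)).
Qed.

(** The arguments are read in the registers [args], the value is left in [out], and
the registers from [b] on are scratch space.  Arguments are preserved and scratch
registers are empty again at the end, so calls can be nested by moving [b] up.

In the recursion, [b] is the loop counter, [b + 1] the current value, [b + 2] the
next value and [b + 3] the number of rounds left.  In the search, [out] itself is
the candidate. *)
Fixpoint compile n (f : recfun n) (args : seq nat) (out b : nat) : cmd :=
  match f with
  | RZero _ => Skip
  | RSucc => Seq (copy (nth 0 args 0) out b) (Inc out)
  | RProj _ i => copy (nth 0 args i) out b
  | RComp _ k g h =>
      Seq (seqs [seq compile (h i) args (b + i) (b + k) | i : 'I_k <- enum 'I_k])
     (Seq (compile g (iota b k) out (b + k))
          (seqs [seq clear (b + i) | i : 'I_k <- enum 'I_k]))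
  | RPrec _ g h =>
      Seq (compile g (behead args) b.+1 (b + 4))
     (Seq (copy (nth 0 args 0) (b + 3) (b + 4))
     (Seq (While (b + 3)
            (Seq (Dec (b + 3))
            (Seq (compile h [:: b, b.+1 & behead args] b.+2 (b + 4))
            (Seq (clear b.+1) (Seq (transfer b.+2 b.+1) (Inc b))))))
     (Seq (clear b) (transfer b.+1 out))))
  | RMu _ g =>
      Seq (compile g (out :: args) b b.+1)
          (While b (Seq (clear b) (Seq (Inc out) (compile g (out :: args) b b.+1))))
  end.

Lemma eq_map_in (u v : store) s : {in s, u =1 v} -> map u s = map v s.
Proof. by move=> uv; apply/eq_in_map. Qed.

(** One direction is enough: programs are deterministic, and only runs on which the
function is defined matter. *)
Lemma compile_correct n (f : recfun n) (x : n.-tuple nat) y args out b u :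
  computes f x y -> all (ltn^~ b) args -> out < b -> out \notin args ->
  (forall r, b <= r -> u r = 0) -> u out = 0 -> map u args = x ->
  exec (compile f args out b) u (upd u out y).
Proof.
elim: f x y args out b u =>
    {n} [n||n i|n k g IHg h IHh|n g IHg h IHh|n g IHg] x y args out b u /=.
- move=> -> _ _ _ _ uo _; apply: exec_eq (ExecSkip _) _; store_eq.
- move=> -> argsb outb outa ub uo ux.
  case: args ux argsb outa => [|a [|? ?]] ux; try by move/(congr1 size): ux; rewrite size_tuple.
  rewrite /= andbT inE => /= ab oa.
  have tx : thead x = u a by rewrite /thead (tnth_nth 0) -ux.
  apply: ExecSeq (exec_copy _ _) _.
  + by rewrite /= !inE; lia.
  + exact: ub.
  by apply: exec_eq (ExecInc _ _) _; store_eq.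
- move=> -> argsb outb outa ub uo ux.
  have sz : i < size args by rewrite -(size_map u) ux size_tuple.
  have ia : nth 0 args i \in args by apply: mem_nth.
  have ib := allP argsb _ ia.
  have oi : out != nth 0 args i by apply: contraNneq outa => ->.
  apply: exec_eq (exec_copy _ _) _.
  + by rewrite /= !inE; lia.
  + exact: ub.
  by rewrite (tnth_nth 0) -ux (nth_map 0) // uo.
- move=> [z hz gz] argsb outb outa ub uo ux.
  pose U m : store := fun r => if (b <= r < b + m) then nth 0 z (r - b) else u r.
  pose W m : store := fun r => if r == out then y else
    if (b + m <= r < b + k) then nth 0 z (r - b) else u r.
  apply: (@ExecSeq _ _ _ (U k)).
    apply: exec_eq; last by apply: erefl.
    have -> : u = U 0 by apply: funext => r; rewrite /U; case: ifP => //; lia.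
    apply: exec_seqs => i; have ik := ltn_ord i.
    apply: exec_eq (IHh i x (tnth z i) args _ _ _ (hz i) _ _ _ _ _ _) _.
    + by apply/allP => r /(allP argsb) /= rb; lia.
    + lia.
    + by apply/negP => /(allP argsb) /=; lia.
    + by move=> r rb; rewrite /U; case: ifP => [|_]; [lia | apply: ub; lia].
    + by rewrite /U; case: ifP => [|_]; [lia | apply: ub; lia].
    + rewrite -ux; apply: eq_map_in => r /(allP argsb) /= rb.
      by rewrite /U; case: ifP => //; lia.
    apply: funext => r; rewrite /U /upd (tnth_nth 0).
    case: eqP => [->|ne]; first by rewrite addKn; case: ifP => //; lia.
    by congr (if _ then _ else _); lia.
  apply: (@ExecSeq _ _ _ (W 0)).
    apply: exec_eq (IHg z y (iota b k) out (b + k) _ gz _ _ _ _ _ _) _.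
    + by apply/allP => r; rewrite mem_iota /=; lia.
    + lia.
    + by rewrite mem_iota; lia.
    + by move=> r rb; rewrite /U; case: ifP => [|_]; [lia | apply: ub; lia].
    + by rewrite /U; case: ifP => //; lia.
    + rewrite -[RHS](mkseq_nth 0) size_tuple /mkseq -[b in iota b]addn0 iotaDl.
      rewrite -map_comp; apply/eq_in_map => r; rewrite mem_iota /U /= => rk.
      by rewrite addKn; case: ifP => //; lia.
    by apply: funext => r; rewrite /U /W /upd addn0.
  apply: exec_eq; first apply: (@exec_seqs k _ W).
    move=> i; have ik := ltn_ord i; apply: exec_eq (exec_clear _ _) _.
    apply: funext => r; rewrite /W /upd; case: eqP => [->|ne].
      by case: eqP => [|_]; [lia | case: ifP => [|_]; [lia | rewrite ub //; lia]].
    by case: eqP => // _; congr (if _ then _ else _); lia.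
  apply: funext => r; rewrite /W /upd; case: eqP => // _.
  by case: ifP => //; lia.
- move=> [s [s0 ss ->]] argsb outb outa ub uo ux.
  case: args ux argsb outa => [|a0 args]; first by move/(congr1 size); rewrite size_tuple.
  rewrite /= inE negb_or => ux /andP[a0b argsb] /andP[oa outa].
  have [ux0 uxs] : u a0 = thead x /\ map u args = behead x.
    by rewrite /thead (tnth_nth 0) -ux.
  set N := thead x in ss ux0 *.
  pose U m := upd (upd (upd u b m) b.+1 (s m)) (b + 3) (N - m).
  have ob i : u (b + i) = 0 by apply: ub; lia.
  have [ob0 ob1 ob2 ob3] := And4 (ob 0) (ob 1) (ob 2) (ob 3).
  rewrite addn0 addn1 addn2 in ob0 ob1 ob2.
  apply: (@ExecSeq _ _ _ (upd u b.+1 (s 0))).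
    apply: (IHg [tuple of behead x]) => //; rewrite /=.
    + by apply/allP => r /(allP argsb) /=; lia.
    + lia.
    + by apply/negP => /(allP argsb) /=; lia.
    + by move=> r rb; apply: ub; lia.
  apply: (@ExecSeq _ _ _ (U 0)).
    apply: exec_eq (exec_copy _ _) _.
    + by rewrite /= !inE; lia.
    + by rewrite /upd; case: eqP => [|_]; [lia | apply: ub; lia].
    by rewrite /U; store_eq.
  apply: (@ExecSeq _ _ _ (U N)).
    have loop j : j <= N -> exec (While (b + 3)
            (Seq (Dec (b + 3))
            (Seq (compile h [:: b, b.+1 & args] b.+2 (b + 4))
            (Seq (clear b.+1) (Seq (transfer b.+2 b.+1) (Inc b)))))) (U (N - j)) (U N).
      elim: j => [|j IHj] le.
        by rewrite subn0; apply: ExecDone; rewrite /U /upd eqxx subnn.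
      apply: ExecLoop (IHj (ltnW le)).
        by rewrite /U /upd eqxx; lia.
      set m := N - j.+1; have mN : m < N by lia.
      apply: ExecSeq (ExecDec _ _) _.
      apply: (@ExecSeq _ _ _ (upd (upd (U m) (b + 3) (N - m.+1)) b.+2 (s m.+1))).
        apply: exec_eq (IHh [tuple of m :: s m :: behead x] _ _ _ _ _ (ss m mN) _ _ _ _ _ _) _.
        + apply/allP => r; rewrite !inE => /or3P[/eqP->|/eqP->|/(allP argsb)] /=; lia.
        + lia.
        + rewrite !inE !negb_or; apply/and3P; split; try lia.
          by apply/negP => /(allP argsb) /=; lia.
        + move=> r rb; rewrite /U /upd; do 4?[case: eqP => [|_]; first lia].
          by apply: ub; lia.
        + rewrite /U /upd; do 4?[case: eqP => [|_]; first lia].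
          by [].
        + rewrite /= -uxs; congr [:: _, _ & _].
          * by rewrite /U /upd; repeat case: eqP => //=; lia.
          * by rewrite /U /upd; repeat case: eqP => //=; lia.
          apply: eq_map_in => r /(allP argsb) /= rb; rewrite /U /upd.
          by do 4?[case: eqP => [|_]; first lia].
        by rewrite /U; store_eq.
      apply: ExecSeq (exec_clear _ _) (ExecSeq (exec_transfer _ _) _); first by lia.
      apply: exec_eq (ExecInc _ _) _.
      have -> : N - j = m.+1 by lia.
      by rewrite /U; store_eq.
    by have := loop N (leqnn N); rewrite subnn.
  apply: ExecSeq (exec_clear _ _) _; apply: exec_eq (exec_transfer _ _) _; first by lia.
  by rewrite /U; store_eq.
- move=> [y0 ym] argsb outb outa ub uo ux.
  have [v [vy vm]] : exists v : nat -> nat, v y = 0 /\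
      forall m, m <= y -> computes g [tuple of m :: x] (v m) /\ (m < y -> v m != 0).
    have /choice[v vP] : forall m, exists k, m <= y ->
        computes g [tuple of m :: x] k /\ (m < y -> k != 0) /\ (m = y -> k = 0).
      move=> m; case: (ltngtP m y) => [lt|gt|->].
      + by have [k gk] := ym _ lt; exists k.+1 => _; split => //; split => //; lia.
      + by exists 0; lia.
      + by exists 0 => _; split.
    exists v; split; first by have [_ [_]] := vP y (leqnn y); apply.
    by move=> m le; have [? [? _]] := vP m le.
  pose U m := upd (upd u out m) b (v m).
  have step m w : m <= y -> w = upd u out m ->
      exec (compile g (out :: args) b b.+1) w (U m).
    move=> le ->; apply: exec_eq (IHg [tuple of m :: x] (v m) _ _ _ _ _ _ _ _ _ _ _) _.
    + by have [] := vm m le.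
    + by apply/allP => r; rewrite inE => /predU1P[->|/(allP argsb)] /=; lia.
    + lia.
    + rewrite inE; apply/negP => /predU1P[|/(allP argsb) /=]; lia.
    + move=> r rb; rewrite /upd; case: eqP => [|_]; [lia | apply: ub; lia].
    + rewrite /upd; case: eqP => [|_]; [lia | exact: ub].
    + rewrite /= {1}/upd eqxx -ux; congr cons; apply: eq_map_in => r ra.
      by rewrite /upd; case: eqP => // ro; rewrite -ro ra in outa.
    by [].
  apply: (@ExecSeq _ _ _ (U 0)); first by apply: step => //; store_eq.
  have loop j : j <= y -> exec (While b (Seq (clear b) (Seq (Inc out)
      (compile g (out :: args) b b.+1)))) (U (y - j)) (upd u out y).
    elim: j => [|j IHj] le.
      rewrite subn0; apply: exec_eq (ExecDone _ _) _; first by rewrite /U /upd eqxx.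
      rewrite /U vy; apply: funext => r; rewrite /upd; case: eqP => // ->.
      by rewrite ub // ; case: eqP => //; lia.
    apply: ExecLoop (IHj (ltnW le)).
      by rewrite /U /upd eqxx; have [_] := vm (y - j.+1) (leq_subr _ _); apply; lia.
    apply: ExecSeq (exec_clear _ _) (ExecSeq (ExecInc _ _) _).
    apply: step; first by lia.
    have ob := ub b (leqnn b); rewrite /U; store_eq.
  by have := loop y (leqnn y); rewrite subnn.
Qed.

(** * The random walk of a counter machine *)

(** [JZ r t] jumps to position [t] if register [r] is empty and otherwise moves on,
as do [INC] and [DEC]. *)
Inductive instr :=
| INC of nat
| DEC of nat
| JZ of nat & nat
| JMP of nat.

Definition top n (P : pred nat) := iteri n (fun i t => if P i then i else t) 0.
Arguments top : simpl never.

Lemma topP n (P : pred nat) : has P (iota 0 n) ->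
  [/\ top n P < n, P (top n P) & forall i, i < n -> P i -> i <= top n P].
Proof.
elim: n => // n IHn; rewrite -addn1 iotaD has_cat add0n /= addn1 orbF.
case Pn: (P n); rewrite (orbT, orbF).
  by rewrite /top /= Pn; split => // i; rewrite ltnS.
move=> /IHn; rewrite /top /= Pn; set t := iteri _ _ _ => -[tn Pt ti]; split => //.
  exact: ltnW.
move=> i; rewrite ltnS leq_eqVlt => /predU1P[->|]; first by rewrite Pn.
exact: ti.
Qed.

Lemma topE n (P : pred nat) j : j < n -> P j -> (forall i, i < n -> P i -> i <= j) ->
  top n P = j.
Proof.
move=> jn Pj hi; have [|tn Pt ti] := @topP n P.
  by apply/hasP; exists j => //; rewrite mem_iota.
by apply/eqP; rewrite eqn_leq hi // ti.
Qed.

(** [u] and [v] are the coordinates that go up and down.  A coordinate in both stays,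
and this makes an instruction that jumps to itself harmless. *)
Definition mkmove d (u v : pred nat) : move d :=
  [ffun i : 'I_d => inord (1 + u i - v i)].

Lemma mkmoveE d (u v : pred nat) (i : 'I_d) : mkmove d u v i = 1 + u i - v i :> nat.
Proof. by rewrite ffunE inordK //; case: (u i) (v i) => [] []. Qed.

Lemma disp_mkmove d (u v : pred nat) (i : 'I_d) :
  disp (mkmove d u v) i = ((u i)%:Z - (v i)%:Z)%R.
Proof. by rewrite /disp mkmoveE; case: (u i) (v i) => [] []. Qed.

(** Faces are turned into predicates on all numbers, so that the rules of the walk do
not mention the dimension and can be compared with bits of numbers. *)
Definition active d (L : {set 'I_d}) : pred nat :=
  fun i => [exists j in L, val j == i].

Lemma activeE d (L : {set 'I_d}) (i : 'I_d) : active L i = (i \in L).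
Proof.
apply/idP/idP => [/existsP[j /andP[jL /eqP/val_inj <-]] //|iL].
by apply/existsP; exists i; rewrite iL eqxx.
Qed.

Lemma active_lt d (L : {set 'I_d}) i : active L i -> i < d.
Proof. by move=> /existsP[j /andP[_ /eqP<-]]; apply: ltn_ord. Qed.

Lemma has_active d (L : {set 'I_d}) : has (active L) (iota 0 d) = (L != finset.set0).
Proof.
apply/hasP/set0Pn => [[i _ /existsP[j /andP[jL _]]]|[i iL]]; first by exists j.
by exists (val i); rewrite ?activeE // mem_iota /=.
Qed.

Section Machine.
Variables (K : nat) (prog : seq instr) (k : nat).

(** Program positions are coordinates, counted from the end: the instruction at
position [j] moves on to [j - 1], and the program ends at position [K].  The
positions from [core_dim] on are extra ones that load the input, so adding them
does not renumber the others. *)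
Definition core_dim := (K + size prog).+1.

(** At the end of the program, position [K], the jump to coordinate 1 removes the last
program position and puts a unit in register 1. *)
Definition instr_at j := if j < core_dim then nth (JMP 1) (JMP 1 :: prog) (j - K) else INC 0.
Let d := core_dim + k.

(** The coordinates that go up and those that go down.  The position that counts is the
largest active coordinate, even on faces that no run meets, where several positions
are active.  At most one more coordinate goes up than goes down, and only active
coordinates go down: these two facts make the walk of every program valid. *)
Definition sim (P : pred nat) : seq nat * seq nat :=
  if ~~ has P (iota 0 d) then ([:: d.-1], [::]) else
  let j := top d P in
  if j < K then ([:: j], [::]) else
  match instr_at j with
  | INC r => ([:: j.-1; r], [:: j])
  | DEC r => ([:: j.-1], if P r then [:: j; r] else [:: j])
  | JZ r t => ([:: if P r then j.-1 else t], [:: j])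
  | JMP t => ([:: t], [:: j])
  end.

Definition sim_move (L : {set 'I_d}) : move d :=
  mkmove d (mem (sim (active L)).1) (mem (sim (active L)).2).
Definition drain_move (L : {set 'I_d}) : move d := mkmove d pred0 (active L).

Definition machine_prob : {ffun {set 'I_d} * move d -> rat} :=
  [ffun x => (if x.2 == sim_move x.1 then 4%:Q / 9%:Q else 0) +
             (if x.2 == drain_move x.1 then 5%:Q / 9%:Q else 0)]%R.

Definition machine : instance :=
  @Instance d machine_prob [ffun=> 1%R] 1%R [ffun i : 'I_d => nat_of_bool (i == 1 :> nat)].

Lemma sim_down_active (P : pred nat) i : i \in (sim P).2 -> P i.
Proof.
rewrite /sim; case: ifP => // /negbFE/topP[_ Pt _]; case: ifP => // _.
case: (instr_at _) => [r|r|r t|t] /=; try by rewrite inE => /eqP->.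
by case: ifP => Pr; rewrite !inE; [move=> /predU1P[->|/eqP->] | move=> /eqP->].
Qed.

Lemma sum_move_prob (V : lmodType rat) (L : {set 'I_d}) (f : move d -> V) :
  (\sum_D machine_prob (L, D) *: f D =
   (4%:Q / 9%:Q) *: f (sim_move L) + (5%:Q / 9%:Q) *: f (drain_move L))%R.
Proof.
under eq_bigr => D _ do rewrite ffunE scalerDl /=.
have E c (D0 : move d) :
    (\sum_(D : move d) (if D == D0 then c else 0) *: f D = c *: f D0)%R.
  rewrite (bigD1 D0) //= eqxx big1 ?addr0 // => D /negPf->.
  by rewrite scale0r.
by rewrite big_split /= !E.
Qed.

Lemma machine_is_walk : is_walk machine.
Proof.
split => /=.
- by move=> L D; rewrite ffunE; apply: addr_ge0; case: ifP.
- move=> L; under eq_bigr => D _ do rewrite -[machine_prob _]mulr1.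
  by rewrite (@sum_move_prob rat^o L (fun=> 1%R)).
- move=> L D i iL disp1; rewrite ffunE /=.
  case: eqP => [E|_].
    have : val i \in (sim (active L)).2.
      move: disp1; rewrite E disp_mkmove /=; case: (val i \in _.2) => //.
    by move/sim_down_active; rewrite activeE (negPf iL).
  case: eqP => [E|_]; last by rewrite addr0.
  by move: disp1; rewrite E disp_mkmove /= activeE (negPf iL).
Qed.

Definition sim_step (q : state d) : state d :=
  let m := sim (active (face q)) in
  [ffun i : 'I_d => q i + (val i \in m.1) - (val i \in m.2)].
Definition drain_step (q : state d) : state d := [ffun i => (q i).-1].

Lemma move_stepP (q q' : state d) (u v : pred nat) :
  (forall i : 'I_d, v i -> 0 < q i) ->
  [forall i, ((q' i)%:Z == (q i)%:Z + disp (mkmove d u v) i)%R] =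
  (q' == [ffun i : 'I_d => q i + u i - v i]).
Proof.
move=> vq; apply/forallP/eqP => [E|-> i].
  apply/ffunP => i; have /eqP := E i; rewrite disp_mkmove ffunE; move: (vq i).
  by case: (v i) => [/(_ isT)|_]; case: (u i) => /=; lia.
rewrite disp_mkmove ffunE; move: (vq i).
by case: (v i) => [/(_ isT)|_]; case: (u i) => /=; lia.
Qed.

Lemma transE (R : realType) (q q' : state d) :
  @trans R machine q q' = ((4 / 9) *+ (q' == sim_step q) + (5 / 9) *+ (q' == drain_step q))%R.
Proof.
rewrite /trans /=.
pose C (D : move d) := [forall i, ((q' i)%:Z == (q i)%:Z + disp D i)%R].
have E (c : rat) D0 : (\sum_(D : move d | C D) ratr (if D == D0 then c else 0%R) = ratr c
    *+ C D0 :> R)%R.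
  rewrite big_mkcond (bigD1 D0) //= eqxx big1 ?addr0 => [|D /negPf->].
    by case: (C D0).
  by rewrite rmorph0 if_same.
under eq_bigr => D _ do rewrite ffunE rmorphD /=.
rewrite big_split /= !E /C !move_stepP.
- congr (_ *+ nat_of_bool _ + _ *+ nat_of_bool _)%R.
  congr (_ == _); apply/ffunP => i; rewrite !ffunE activeE !inE /= addn0.
  by case: (q i) => [|n] /=; rewrite ?subn1.
- by move=> i; rewrite activeE inE.
- by move=> i /sim_down_active; rewrite activeE inE.
Qed.
End Machine.
Arguments core_dim : simpl never.

(** * Stationary distributions of chains with two successors *)

Section ProbabilityPart.
Local Open Scope classical_set_scope.
Local Open Scope ring_scope.

Lemma esumZl (R : realType) (T : choiceType) (S : set T) (c : R) (f : T -> \bar R) :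
  0 <= c -> (forall i, 0 <= f i)%E ->
  (\esum_(i in S) (c%:E * f i) = c%:E * \esum_(i in S) f i)%E.
Proof.
move=> c0 f0; rewrite /esum -ereal_supZl //; last first.
  by apply/set0P; exists 0%E; exists set0; [exact: fsets_set0 | rewrite fsbig_set0].
congr ereal_sup; apply/seteqP; split => [_ [A [fA AS] <-]|_ [_ [A [fA AS] <-] <-]] /=.
  by exists (\sum_(i \in A) f i)%E; [exists A | rewrite ge0_mule_fsumr].
by exists A => //; rewrite ge0_mule_fsumr.
Qed.

Lemma esum_exchange (R : realType) (T U : choiceType) (S : set T) (V : set U) (f : T -> U
    -> \bar R) :
  (forall i j, 0 <= f i j)%E ->
  (\esum_(i in S) \esum_(j in V) f i j = \esum_(j in V) \esum_(i in S) f i j)%E.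
Proof.
move=> f0; rewrite !esum_esum //.
rewrite (reindex_esum (S `*`` (fun=> V)) _ (fun k : T * U => (k.2, k.1))) //.
split => //; first by move=> [i j] [].
  by move=> [i j] [i' j'] _ _ /= [-> ->].
by move=> [j i] [Vj Si]; exists (i, j).
Qed.

Lemma esum_pick (R : realType) (T : choiceType) (q : T) (f : T -> R) : (0 <= f q) ->
  (\esum_(i in [set: T]) ((q == i)%:R * f i)%:E = (f q)%:E)%E.
Proof.
move=> f0; rewrite -(@esum_set1 _ _ q (fun i => (f i)%:E)) ?lee_fin // [RHS]esum_mkcond.
apply: eq_esum => i _; rewrite in_set1 eq_sym.
by case: eqP; rewrite ?mul1r ?mul0r.
Qed.

Lemma esum_shift (R : realType) (f : nat -> \bar R) : (forall t, 0 <= f t)%E ->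
  (\esum_(t in [set: nat]) f t = f 0%N + \esum_(t in [set: nat]) f t.+1)%E.
Proof.
move=> f0; rewrite -!nneseries_esumT // nneseries_recl //; congr (_ + _)%E.
rewrite -(nneseries_addn 1) //.
by congr (limn _); apply: funext => n; apply: eq_bigr => i _; rewrite addn1.
Qed.

Section TwoBranch.
Variables (R : realType) (S : choiceType) (a b : S -> S) (z : S) (phi : S -> nat).
Hypothesis phi_z : phi z = 0%N.
Hypothesis phi_a : forall q, (phi (a q) <= (phi q).+1)%N.
Hypothesis phi_b : forall q, q != z -> (phi (b q) < phi q)%N.
Hypothesis b_z : b z = z.

Definition branch (q q' : S) : R := (4 / 9) *+ (q' == a q) + (5 / 9) *+ (q' == b q).

(** The chain killed on its return to [z]: the expectation of [f] after [t] steps, on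
the event that none of them has led to [z].  This backward recursion avoids infinite
sums over states. *)
Fixpoint taboo (t : nat) (f : S -> R) (q : S) : R :=
  if t is s.+1 then
    4 / 9 * ((a q != z)%:R * taboo s f (a q)) + 5 / 9 * ((b q != z)%:R * taboo s f (b q))
  else f q.

Definition at_point (q q' : S) : R := (q' == q)%:R.

Lemma branch_ge0 q q' : 0 <= branch q q'.
Proof. by rewrite /branch; do 2!case: (_ == _); rewrite ?mulr1n ?mulr0n; lra. Qed.

Lemma taboo_ge0 t f q : (forall p, 0 <= f p) -> 0 <= taboo t f q.
Proof.
move=> f0; elim: t q => //= t IHt q.
have := IHt (a q); have := IHt (b q); case: (a q != z); case: (b q != z);
  rewrite ?(mul1r, mul0r); lra.
Qed.

Lemma tabooD t f g q : taboo t (fun p => f p + g p) q = taboo t f q + taboo t g q.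
Proof. by elim: t q => //= t IHt q; rewrite !IHt; ring. Qed.

Lemma tabooZ t c f q : taboo t (fun p => c * f p) q = c * taboo t f q.
Proof. by elim: t q => //= t IHt q; rewrite !IHt; ring. Qed.

Lemma tabooS t f q : taboo t (taboo 1 f) q = taboo t.+1 f q.
Proof. by elim: t q => // t IHt q; rewrite [LHS]/= !IHt. Qed.

Lemma eq_taboo t f g q : f =1 g -> taboo t f q = taboo t g q.
Proof. by move=> fg; elim: t q => //= t IHt q; rewrite !IHt. Qed.

(** Recovers the kernel of the killed chain from the backward recursion: the mass that
it puts on [p] at time [t] is [taboo t (at_point p)]. *)
Lemma taboo_pairing t F q : (forall p, 0 <= F p) ->
  (\esum_(p in [set: S]) (taboo t (at_point p) q * F p)%:E = (taboo t F q)%:E)%E.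
Proof.
move=> F0; elim: t q => [|t IHt] q /=; first exact: esum_pick.
have tF0 p r : 0 <= taboo t (at_point p) r * F p.
  by rewrite mulr_ge0 ?taboo_ge0 // => ?; rewrite ler0n.
pose c (e : R) (r : S) := e * (r != z)%:R.
have c0 e r : 0 <= e -> 0 <= c e r by move=> e0; rewrite /c mulr_ge0 ?ler0n.
rewrite (eq_esum (b := fun p => ((c (4 / 9) (a q))%:E * (taboo t (at_point p) (a q) * F p)%:E
    + (c (5 / 9) (b q))%:E * (taboo t (at_point p) (b q) * F p)%:E)%E)); last first.
  by move=> p _; rewrite -!EFinM -EFinD /c; congr EFin; ring.
have c4 := c0 (4 / 9) (a q) ltac:(lra); have c5 := c0 (5 / 9) (b q) ltac:(lra).
rewrite esumD; last 2 first.
- by move=> p _; rewrite -EFinM lee_fin mulr_ge0.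
- by move=> p _; rewrite -EFinM lee_fin mulr_ge0.
rewrite !esumZl // ?IHt; try by move=> p; rewrite lee_fin.
by rewrite -!EFinM -EFinD /c; congr EFin; ring.
Qed.

(** The function [9 * phi] loses at least one on average in each step away from [z],
because 4/9 * (phi + 1) + 5/9 * (phi - 1) = phi - 1/9.  So it bounds the expected
time until the return to [z]. *)
Lemma taboo_sum n q : q != z -> \sum_(t < n) taboo t (fun=> 1) q <= 9 * (phi q)%:R.
Proof.
elim: n q => [|n IHn] q qz; first by rewrite big_ord0 mulr_ge0 // ler0n.
rewrite big_ord_recl /= big_split /= -!mulr_sumr.
have Ha : (a q != z)%:R * \sum_(i < n) taboo i (fun=> 1) (a q) <= 9 * (phi q)%:R + 9.
  have : (phi (a q))%:R <= (phi q)%:R + 1 :> R by rewrite natr1 ler_nat phi_a.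
  have := IHn (a q); case: (a q != z) => /= [/(_ isT)|_]; rewrite ?(mul1r, mul0r).
    by lra.
  by have : 0 <= (phi q)%:R :> R by []; lra.
have Hb : (b q != z)%:R * \sum_(i < n) taboo i (fun=> 1) (b q) <= 9 * (phi q)%:R - 9.
  have : (phi (b q))%:R + 1 <= (phi q)%:R :> R by rewrite natr1 ler_nat phi_b.
  have : 0 <= (phi (b q))%:R :> R by [].
  have := IHn (b q); case: (b q != z) => /= [/(_ isT)|_]; rewrite ?(mul1r, mul0r); lra.
by rewrite /bump /=; lra.
Qed.

(** From [z] the only step that does not stay is to a point where [phi] is at most 1,
whence 1 + 4/9 * 9. *)
Lemma taboo_sum_z n : \sum_(t < n) taboo t (fun=> 1) z <= 5.
Proof.
case: n => [|n]; first by rewrite big_ord0; lra.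
rewrite big_ord_recl /= big_split /= -!mulr_sumr b_z eqxx mul0r mulr0.
have : (a z != z)%:R * \sum_(i < n) taboo i (fun=> 1) (a z) <= 9.
  have : (phi (a z))%:R <= 1 :> R by rewrite lern1 (leq_trans (phi_a z)) // phi_z.
  by have := @taboo_sum n (a z); case: (a z != z) => /= [/(_ isT)|_];
      rewrite ?(mul1r, mul0r); lra.
by rewrite /bump /=; lra.
Qed.

Definition excursion : \bar R := (\esum_(t in [set: nat]) (taboo t (fun=> 1) z)%:E)%E.

(** Expected number of visits before the return to [z], the start included.  This is the
unnormalized stationary measure. *)
Definition visits (q : S) : \bar R := (\esum_(t in [set: nat]) (taboo t (at_point q) z)%:E)%E.

Lemma at_point_ge0 q p : 0 <= at_point q p. Proof. exact: ler0n. Qed.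

Lemma visits_ge0 q : (0 <= visits q)%E.
Proof. by apply: esum_ge0 => t _; rewrite lee_fin taboo_ge0 // => p; apply: at_point_ge0. Qed.

Lemma excursion_bounds : (1 <= excursion <= 5%:E)%E.
Proof.
have t0 t : (0 <= (taboo t (fun=> 1) z)%:E)%E by rewrite lee_fin taboo_ge0.
apply/andP; split.
  rewrite /excursion esum_shift // leeDl // esum_ge0 // => t _; exact: t0.
rewrite /excursion -nneseries_esumT //; apply: lime_le; first exact: is_cvg_nneseries.
by near=> n; rewrite big_mkord sumEFin lee_fin taboo_sum_z.
Unshelve. all: by end_near.
Qed.

Lemma sum_visits F : (forall p, 0 <= F p) ->
  (\esum_(p in [set: S]) (visits p * (F p)%:E) = \esum_(t in [set: nat]) (taboo t F z)%:E)%E.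
Proof.
move=> F0.
rewrite (eq_esum (b := fun p => \esum_(t in [set: nat]) (taboo t (at_point p) z * F p)%:E)%E).
  rewrite esum_exchange; last first.
    by move=> p t; rewrite lee_fin mulr_ge0 // taboo_ge0 // => ?; apply: at_point_ge0.
  by apply: eq_esum => t _; rewrite taboo_pairing.
move=> p _; rewrite muleC -esumZl //; last first.
  by move=> t; rewrite lee_fin taboo_ge0 // => ?; apply: at_point_ge0.
by apply: eq_esum => t _; rewrite -EFinM mulrC.
Qed.

(** One step of the chain is one step of the killed chain, plus the killed mass put
back at [z]. *)
Lemma branch_taboo p q :
  branch p q = taboo 1 (at_point q) p + (q == z)%:R * (1 - taboo 1 (fun=> 1) p).
Proof.
rewrite /branch /at_point /= !(eq_sym q).
have [->|qz] := eqVneq z q.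
  by do 2!case: (_ == q) => /=; rewrite ?mulr1n ?mulr0n; lra.
have E r : (r != z)%:R * (r == q)%:R = (r == q)%:R :> R.
  by have [->|] := eqVneq r q; rewrite ?mulr0 // eq_sym qz mulr1.
by rewrite !E mul0r addr0 !mulr_natr.
Qed.

(** One more step shifts the sum over times, so it loses the visit at time 0 and
gains at [z] the probability of returning.  This probability is 1 as the excursion
has finite expected length. *)
Lemma visits_stationary q :
  (\esum_(p in [set: S]) (visits p * (branch p q)%:E) = visits q)%E.
Proof.
rewrite sum_visits; last by move=> p; apply: branch_ge0.
have u0 t p r : (0 <= (taboo t (at_point p) r)%:E)%E.
  by rewrite lee_fin taboo_ge0 // => ?; apply: at_point_ge0.
have one0 t p : (0 <= (taboo t (fun=> 1) p)%:E)%E by rewrite lee_fin taboo_ge0.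
pose h p := 1 - taboo 1 (fun=> 1) p.
have h0 p : 0 <= h p.
  by rewrite /h /=; do 2!case: (_ == z); rewrite /= ?mulr1 ?mulr0; lra.
have th0 t p : (0 <= (taboo t h p)%:E)%E by rewrite lee_fin taboo_ge0.
(* The killed masses [taboo t h] telescope: added to the survivors at time [t + 1] they
   give the survivors at time [t], and the sums over [t] are finite. *)
have ret : (\esum_(t in [set: nat]) (taboo t h z)%:E = 1)%E.
  have fin : (\esum_(t in [set: nat]) (taboo t.+1 (fun=> 1) z)%:E)%E \is a fin_num.
    have /andP[_] := excursion_bounds; rewrite /excursion esum_shift // => le.
    rewrite ge0_fin_numE ?esum_ge0 //; first by apply: le_lt_trans (ltry 5);
        apply: le_trans le; rewrite leeDr.
  rewrite -[LHS](addeK _ fin) -[RHS](addeK _ fin); congr (_ - _)%E.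
  rewrite -esumD // -[RHS](esum_shift (one0^~ z)).
  apply: eq_esum => t _; rewrite -tabooS -EFinD -tabooD; congr EFin.
  by apply: eq_taboo => p; rewrite /h subrK.
rewrite (eq_esum (b := fun t => ((taboo t.+1 (at_point q) z)%:E + (q == z)%:R%:E * (taboo t
    h z)%:E)%E)).
  rewrite esumD // ?esumZl ?ler0n //; last by move=> t _;
      rewrite -EFinM lee_fin mulr_ge0 ?ler0n // -lee_fin.
  rewrite ret mule1 /visits [in RHS]esum_shift // addeC; congr (_ + _)%E.
  by rewrite /= /at_point eq_sym.
move=> t _; rewrite -EFinM -EFinD -tabooS -tabooZ -tabooD; congr EFin.
by apply: eq_taboo => p; rewrite branch_taboo.
Qed.

Definition invariant_distribution (pi : S -> R) : Prop :=
  [/\ forall q, 0 <= pi q,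
      (\esum_(q in [set: S]) (pi q)%:E = 1)%E
    & forall q, (\esum_(p in [set: S]) (pi p * branch p q)%:E = (pi q)%:E)%E].

Lemma invariant_distribution_exists : exists pi, invariant_distribution pi.
Proof.
have total : (\esum_(p in [set: S]) visits p = excursion)%E.
  rewrite /excursion -sum_visits //.
  by apply: eq_esum => p _; rewrite mule1.
have /andP[e1 e5] := excursion_bounds.
have efin : excursion \is a fin_num.
  by rewrite ge0_fin_numE ?(le_lt_trans e5) ?ltry // (le_trans _ e1).
have vfin q : visits q \is a fin_num.
  rewrite ge0_fin_numE ?visits_ge0 //; apply: le_lt_trans (ltry 5); apply: le_trans e5.
  rewrite -total (esumID [set q]); last by move=> ? _; apply: visits_ge0.
  rewrite setTI esum_set1 ?visits_ge0 // leeDl // esum_ge0 // => ? _; exact: visits_ge0.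
have e_gt0 : 0 < fine excursion by rewrite fine_gt0 // (lt_le_trans _ e1) //= -ge0_fin_numE
    // (le_trans _ e1).
exists (fun q => (fine excursion)^-1 * fine (visits q)); split.
- by move=> q; rewrite mulr_ge0 ?invr_ge0 ?(ltW e_gt0) // fine_ge0 // visits_ge0.
- rewrite (eq_esum (b := fun q => ((fine excursion)^-1%:E * visits q)%E)); last first.
    by move=> q _; rewrite EFinM fineK.
  rewrite esumZl ?invr_ge0 ?(ltW e_gt0) //; last exact: visits_ge0.
  by rewrite total -(fineK efin) -EFinM mulVf ?gt_eqF.
move=> q.
rewrite (eq_esum (b := fun p => ((fine excursion)^-1%:E * (visits p * (branch p q)%:E))%E)).
  rewrite esumZl ?invr_ge0 ?(ltW e_gt0) ?visits_stationary ?EFinM ?fineK //.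
  by move=> p; rewrite mule_ge0 ?visits_ge0 // lee_fin branch_ge0.
by move=> p _; rewrite -[visits p]fineK // -!EFinM mulrA.
Qed.

Section Invariant.
Variable pi : S -> R.
Hypothesis piP : invariant_distribution pi.

Lemma invariant_ge0 q : 0 <= pi q. Proof. by case: piP. Qed.

Lemma invariant_step p q : pi p * branch p q <= pi q.
Proof.
have [pi0 _ st] := piP; rewrite -lee_fin -st (esumID [set p]); last first.
  by move=> r _; rewrite lee_fin mulr_ge0 ?branch_ge0.
rewrite setTI esum_set1; last by rewrite lee_fin mulr_ge0 ?branch_ge0.
by rewrite leeDl // esum_ge0 // => r _; rewrite lee_fin mulr_ge0 ?branch_ge0.
Qed.

Lemma invariant_iter_a n q : (4 / 9) ^+ n * pi q <= pi (iter n a q).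
Proof.
elim: n => [|n IHn] /=; first by rewrite expr0 mul1r.
apply: le_trans (invariant_step (iter n a q) _); rewrite /branch eqxx mulr1n.
have : 0 <= (5 / 9) *+ (a (iter n a q) == b (iter n a q)) :> R.
  by case: (_ == _); rewrite ?mulr1n ?mulr0n; lra.
move/(mulr_ge0 (invariant_ge0 (iter n a q))); rewrite mulrDr exprS -mulrA.
by move: IHn; move: (_ ^+ n * _) => x IHn; lra.
Qed.

Lemma invariant_b q : 5 / 9 * pi q <= pi (b q).
Proof.
apply: le_trans (invariant_step q _); rewrite /branch eqxx mulr1n.
have : 0 <= (4 / 9) *+ (b q == a q) :> R.
  by case: (_ == _); rewrite ?mulr1n ?mulr0n; lra.
by move/(mulr_ge0 (invariant_ge0 q)); rewrite mulrDr; lra.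
Qed.

Lemma iter_b_z q : iter (phi q) b q = z.
Proof.
have zb n : iter n b z = z by elim: n => //= n ->.
have [n] := ubnP (phi q); elim: n q => // n IHn q le.
have [->|qz] := eqVneq q z; first exact: zb.
have lt := phi_b qz; rewrite -(subnK lt) iterD iterSr.
rewrite IHn; first exact: zb.
exact: leq_trans lt le.
Qed.

(** Some state has positive mass, and draining carries a positive part of it to [z]. *)
Lemma invariant_z_gt0 : 0 < pi z.
Proof.
have [pi0 s1 _] := piP.
have [q q0] : exists q, 0 < pi q.
  apply: contrapT => H; move: s1; rewrite esum1; first by move=> /esym/eqP;
      rewrite eqe oner_eq0.
  move=> q _; congr EFin; apply/eqP; apply: contrapT => /negP q0; apply: H.
  by exists q; rewrite lt0r q0 pi0.
rewrite -(iter_b_z q); elim: (phi q) => //= n gt0.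
by have := invariant_b (iter n b q); lra.
Qed.

(** Mass enters a closed set and never leaves it, so in equilibrium none enters.  A
state of positive mass outside would however send mass along its draining path,
which ends at [z]. *)
Lemma invariant_closed (C : set S) q : C z ->
  (forall p, C p -> C (a p)) -> (forall p, C p -> C (b p)) -> ~ C q -> pi q = 0.
Proof.
move=> Cz Ca Cb; have [pi0 s1 st] := piP.
have pb0 p r : (0 <= (pi p * branch p r)%:E)%E by rewrite lee_fin mulr_ge0 ?branch_ge0.
pose into p := (\esum_(r in C) (pi p * branch p r)%:E)%E.
have into0 p : (0 <= into p)%E by apply: esum_ge0.
have intoE p : into p = (4 / 9 * (pi p * (a p \in C)%:R) + 5 / 9 * (pi p * (b p \in C)%:R))%:E.
  rewrite /into esum_mkcond; pose F r := pi p * (r \in C)%:R.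
  have F0 r : 0 <= F r by rewrite mulr_ge0 ?ler0n.
  rewrite (eq_esum (b := fun r => ((4 / 9)%:E * ((a p == r)%:R * F r)%:E
      + (5 / 9)%:E * ((b p == r)%:R * F r)%:E)%E)).
    have f0 r s : (0 <= ((s == r)%:R * F r)%:E)%E by rewrite lee_fin mulr_ge0 ?ler0n.
    have c4 : 0 <= 4 / 9 :> R by lra.
    have c5 : 0 <= 5 / 9 :> R by lra.
    rewrite esumD ?esumZl //; last 2 first.
    - by move=> r _; rewrite -EFinM lee_fin mulr_ge0 // -lee_fin.
    - by move=> r _; rewrite -EFinM lee_fin mulr_ge0 // -lee_fin.
    by rewrite !esum_pick // -!EFinM -EFinD.
  move=> r _; rewrite -!EFinM -EFinD /F /branch !(eq_sym r).
  case: (r \in C); case: (a p == r); case: (b p == r) => /=; congr EFin;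
    rewrite ?mulr1n ?mulr0n ?mulr1 ?mulr0 //; lra.
have intoC p : C p -> into p = (pi p)%:E.
  move=> Cp; rewrite intoE !mem_set ?mulr1; [|exact: Cb|exact: Ca].
  by congr EFin; lra.
have mass : (\esum_(r in C) (pi r)%:E = \esum_(p in [set: S]) into p)%E.
  by rewrite /into esum_exchange //; apply: eq_esum => r _; rewrite st.
have out p : ~ C p -> into p = 0%E.
  move: mass; rewrite (esumID C [set: S]) // !setTI (eq_esum intoC).
  set X := (\esum_(r in C) _)%E => E nCp.
  have Xfin : X \is a fin_num.
    have X0 : (0 <= X)%E by apply: esum_ge0 => r _; rewrite lee_fin.
    rewrite ge0_fin_numE //; apply: le_lt_trans (ltry 1).
    by rewrite -s1 (esumID C [set: S]) ?setTI ?leeDl ?esum_ge0 // => r _; rewrite lee_fin.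
  have out0 : (\esum_(r in ~` C) into r = 0)%E.
    by rewrite -[LHS](addeK _ Xfin) [(_ + X)%E]addeC -E subee.
  apply/eqP; rewrite eq_le into0 andbT -out0 (esumID [set p]) //.
  rewrite setIidr; last by move=> _ ->.
  by rewrite esum_set1 // leeDl // esum_ge0.
have stay p : ~ C p -> C (b p) -> pi p = 0.
  move=> nCp Cbp; have := out p nCp; rewrite intoE (mem_set Cbp) => -[].
  by have := pi0 p; case: (_ \in C) => /=; lra.
move=> nCq; apply/eqP; rewrite eq_le pi0 andbT leNgt; apply/negP => q0.
have H n : ~ C (iter n b q) /\ 0 < pi (iter n b q).
  elim: n => // n [nC gt0] /=; split; last by have := invariant_b (iter n b q); lra.
  by move=> /(stay _ nC) p0; rewrite p0 ltxx in gt0.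
by have [] := H (phi q); rewrite iter_b_z.
Qed.
End Invariant.
End TwoBranch.

End ProbabilityPart.

(** * Validity and decay rates of the walk of a machine *)

Lemma sum_mem_le (d : nat) (s : seq nat) : \sum_(i < d) (val i \in s) <= size s.
Proof.
elim: s => [|x s IHs]; first by rewrite big1.
apply: leq_trans (_ : \sum_(i < d) ((val i == x) + (val i \in s)) <= _).
  by apply: leq_sum => i _; rewrite inE; case: (val i == x); case: (val i \in s).
rewrite big_split /= -addn1 addnC leq_add // -big_mkcond /= sum1_card.
have [lt|ge] := ltnP x d.
  by rewrite (fintype.eq_card1 (x := Ordinal lt)) // => i; rewrite !inE -val_eqE.
by rewrite fintype.eq_card0 // => i; rewrite !inE; apply/eqP => E; have := ltn_ord i;
    rewrite E ltnNge ge.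
Qed.

Section MachineWalk.
Variables (K : nat) (prog : seq instr) (k : nat).
Let d := core_dim K prog + k.
Local Notation sim := (sim K prog k).
Local Notation sim_step := (@sim_step K prog k).
Local Notation drain_step := (@drain_step K prog k).
Local Notation machine := (machine K prog k).

(** Raising two coordinates is only possible for an increment, which also lowers its
program position. *)
Lemma sim_balance (P : pred nat) :
  \sum_(i < d) (val i \in (sim P).1) <= (\sum_(i < d) (val i \in (sim P).2)).+1.
Proof.
have small s : size s <= 1 ->
    \sum_(i < d) (val i \in s) <= (\sum_(i < d) (val i \in (sim P).2)).+1.
  by move=> /(leq_trans (sum_mem_le d s)) /leq_trans; apply.
move: small; rewrite /sim; case: ifP => [_|/negbFE/topP[jd _ _]] small; first exact: small.
case: ifP => _ in small *; first exact: small.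
case: (instr_at _) small => [r|r|r t|t] small /=; try exact: small.
apply: leq_trans (sum_mem_le _ _) _ => /=; rewrite ltnS.
by rewrite (bigD1 (Ordinal jd)) //= inE eqxx.
Qed.

Definition total (q : state d) := \sum_i q i.

Lemma total0 : total 0%R = 0.
Proof. by rewrite /total big1 // => i _; rewrite ffunE. Qed.

Lemma active_face (q : state d) (i : 'I_d) : active (face q) i = (0 < q i).
Proof. by rewrite activeE inE. Qed.

Lemma total_sim q : total (sim_step q) <= (total q).+1.
Proof.
have := sim_balance (active (face q)).
set u := (\sum_(i < d) (val i \in _.1)); set v := (\sum_(i < d) (val i \in _.2)) => uv.
suff : total (sim_step q) + v = total q + u by lia.
rewrite /total -!big_split; apply: eq_bigr => i _ /=; rewrite ffunE subnK //.
case di: (_ \in _) => //; move: di => /sim_down_active; rewrite active_face => qi.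
by apply: leq_trans qi (leq_addr _ _).
Qed.

Lemma total_drain q : q != 0%R -> total (drain_step q) < total q.
Proof.
move=> q0; have [i qi] : exists i, 0 < q i.
  apply: contrapT => H; move/eqP: q0; apply; apply/ffunP => i; rewrite ffunE.
  by apply/eqP; rewrite -leqn0 leqNgt; apply/negP => qi; apply: H; exists i.
rewrite /total (bigD1 i) //= [X in _ < X](bigD1 i) //= ffunE.
rewrite -addSn prednK // leq_add2l; apply: leq_sum => j _.
by rewrite ffunE leq_pred.
Qed.

Lemma drain0 : drain_step 0%R = 0%R.
Proof. by apply/ffunP => i; rewrite !ffunE. Qed.

Lemma branch_trans (R : realType) (q q' : state d) :
  @trans R machine q q' = branch R sim_step drain_step q q'.
Proof. exact: transE. Qed.

Lemma machine_irreducible (R : realType) : irreducible R machine.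
Proof.
move=> q; have [n] := ubnP (total q); elim: n q => // n IHn q le.
have [->|q0] := eqVneq q 0%R; first by exists 0%N; rewrite /= eqxx lte_fin.
have [t ht] := IHn (drain_step q) (leq_trans (total_drain q0) le).
exists t.+1 => /=.
have nt0 s p : (0 <= @ntrans R machine s p 0%R)%E.
  elim: s p => [|s IHs] p /=; first by rewrite lee_fin ler0n.
  apply: esum_ge0 => r _; rewrite mule_ge0 // lee_fin branch_trans; exact: branch_ge0.
rewrite (esumID [set drain_step q])%classic; last first.
  by move=> r _; rewrite mule_ge0 // lee_fin branch_trans branch_ge0.
rewrite setTI esum_set1; last by rewrite mule_ge0 // lee_fin branch_trans branch_ge0.
apply: lt_le_trans (leeDl _ _); last first.
  by apply: esum_ge0 => r _; rewrite mule_ge0 // lee_fin branch_trans branch_ge0.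
rewrite mule_gt0 // lte_fin branch_trans /branch eqxx mulr1n.
by case: (_ == _); rewrite ?mulr1n ?mulr0n; lra.
Qed.

Lemma sum_disp (u v : pred nat) :
  (\sum_i disp (mkmove d u v) i = (\sum_(i < d) u i)%N%:Z - (\sum_(i < d) v i)%N%:Z)%R.
Proof.
under eq_bigr => i _ do rewrite disp_mkmove.
by rewrite sumrB !(big_morph Posz PoszD (erefl 0%:Z)%R).
Qed.

Lemma drift_machine (L : {set 'I_d}) : L != finset.set0 ->
  (@drift machine L <= - (1 / 9))%R.
Proof.
move=> L0; rewrite /drift /=.
pose f (D : move d) : rat^o := ((\sum_i disp D i)%:~R)%R.
rewrite (eq_bigr (fun D => machine_prob K prog k (L, D) *: f D)%R); last first.
  move=> D _; rewrite /f mulrC; congr (_ * _)%R; rewrite rmorph_sum /=.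
  by apply: eq_bigr => i _; rewrite ffunE mul1r.
rewrite sum_move_prob /f /GRing.scale /=.
have simL : (((\sum_i disp (@sim_move K prog k L) i)%:~R : rat) <= 1)%R.
  rewrite -[1%R]/(1%:~R)%R ler_int sum_disp.
  rewrite lerBlDr; exact: (sim_balance (active L)).
have drainL : (((\sum_i disp (@drain_move K prog k L) i)%:~R : rat) <= - 1)%R.
  rewrite -[(- 1)%R]/((- 1)%:~R)%R ler_int sum_disp.
  have [i iL] := finset.set0Pn _ L0.
  rewrite big1 // (bigD1 i) //= activeE iL. lia.
move: simL drainL; set x := (\sum_i _)%R; set y := (\sum_i _)%R.
move: (x%:~R)%R (y%:~R)%R => u v; lra.
Qed.

Lemma machine_valid (R : realType) : 0 < d -> valid_instance R machine.
Proof.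
move=> d0; split => //.
- exact: machine_is_walk.
- exact: machine_irreducible.
- split; first by move=> i; rewrite ffunE.
  exists (1 / 9)%R; first by lra.
  move=> L L0.
  have -> : (- (1 / 9) = ratr (- (1 / 9)) :> R)%R.
    by rewrite rmorphN fmorph_div /= rmorph1 ratr_nat.
  by rewrite ler_rat drift_machine.
Qed.

Section Rates.
Variable R : realType.
Let pi : state d -> R := @stationary R machine.

Lemma pi_invariant : invariant_distribution sim_step drain_step pi.
Proof.
have E (p : state d -> R) : @is_stationary R machine p <-> @invariant_distribution R _
    sim_step drain_step p.
  split=> -[p0 p1 p2]; split=> // q; rewrite -[RHS]p2; apply: eq_esum => r _;
    by rewrite branch_trans.
rewrite /pi /stationary; apply/E.
have [p /E pP] := @invariant_distribution_exists R _ sim_step drain_step 0%R total total0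
  total_sim total_drain drain0.
exact: (xgetPex _ (ex_intro _ p pP)).
Qed.

(** The multiples of the direction of the instance. *)
Definition axis_state n : state d := [ffun i : 'I_d => if i == 1 :> nat then n else 0].

Lemma dir_mulrn n : (dir machine *+ n)%R = axis_state n.
Proof.
apply/ffunP => i; rewrite ffunMnE !ffunE /=.
by case: (_ == 1) => //=; rewrite ?mul0rn // -[RHS]natn.
Qed.

Lemma sim_step_axis n : 1 < K -> sim_step (axis_state n.+1) = axis_state n.+2.
Proof.
move=> K1; apply/ffunP => i; rewrite ffunE /sim.
have d1 : 1 < d by rewrite /d /core_dim; lia.
have act (j : 'I_d) : active (face (axis_state n.+1)) j = (j == 1 :> nat).
  by rewrite active_face ffunE; case: (_ == 1).
have hasP : has (active (face (axis_state n.+1))) (iota 0 d).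
  by apply/hasP; exists 1; rewrite ?mem_iota //; have -> := act (Ordinal d1).
have topE1 : top d (active (face (axis_state n.+1))) = 1.
  apply: topE => //; first by have -> := act (Ordinal d1).
  by move=> j jd; have -> := act (Ordinal jd) => /eqP /= ->.
rewrite -/d hasP topE1 K1 /= inE /= !ffunE subn0.
by case: (_ == 1); rewrite ?addn1.
Qed.

Lemma iter_sim_axis n : 1 < K -> iter n sim_step (axis_state 1) = axis_state n.+1.
Proof. by move=> K1; elim: n => //= n ->; rewrite sim_step_axis. Qed.

(** Equivalent to 9/4 < e, which follows from (1 + 1/2)^2 < (e^(1/2))^2. *)
Lemma ln_branch_gt : (- 1 < ln (4 / 9 : R))%R.
Proof.
rewrite -[X in (X < _)%R]expRK ltr_ln ?posrE ?expR_gt0 //.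
have h : (3 / 2 < expR (1 / 2) :> R)%R.
  by apply: le_lt_trans (expR_gt1Dx _) => //; lra.
rewrite expRN.
have -> : (expR 1 = expR (1 / 2) * expR (1 / 2) :> R)%R by rewrite -expRD; congr expR; lra.
have := expR_gt0 (1 / 2 : R); move: (expR _) h => x h x0.
have xx : (9 / 4 < x * x)%R by nra.
rewrite -div1r ltr_pdivrMr; [lra | exact: mulr_gt0].
Qed.

(** The path to register 1 costs a constant factor and each further unit costs 4/9, so
-log pi(v n) <= n * ln (9/4) - ln c, which is below [n] for large [n]. *)
Lemma rate_reachable N : 1 < K -> iter N sim_step 0%R = axis_state 1 ->
  L_minus_le_rate R machine /\ L_plus_le_rate R machine.
Proof.
move=> K1 hit.
suff Lp : L_plus_le_rate R machine.
  by split => //; apply: le_trans Lp; apply: limn_einf_sup.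
have piP := pi_invariant.
have z0 : (0 < pi 0)%R := invariant_z_gt0 total_drain drain0 piP.
pose c := ((4 / 9) ^+ N * pi 0)%R.
have c0 : (0 < c)%R by rewrite mulr_gt0 // exprn_gt0 //; lra.
have low n : ((4 / 9) ^+ n * c <= pi (axis_state n.+1))%R.
  rewrite -iter_sim_axis // -hit; apply: le_trans (invariant_iter_a piP n _).
  by apply: ler_wpM2l (invariant_iter_a piP N 0%R); rewrite exprn_ge0.
pose delta := (1 + ln (4 / 9 : R))%R.
have delta0 : (0 < delta)%R by rewrite /delta; have := ln_branch_gt; lra.
have lowln n : (n%:R * ln (4 / 9) + ln c <= ln (pi (axis_state n.+1)))%R.
  rewrite mulr_natl -lnXn -?lnM ?ler_ln ?posrE ?mulr_gt0 ?exprn_gt0 //; try lra.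
  by apply: lt_le_trans (low n); rewrite mulr_gt0 ?exprn_gt0 //; lra.
pose M := Num.bound `|(- ln c) / delta|%R.
have bd n : (M <= n)%N -> (log_rate R machine n.+1 <= 1)%E.
  move=> Mn; rewrite /log_rate dir_mulrn lne_EFin; last first.
    by apply: lt_le_trans (low n); rewrite mulr_gt0 ?exprn_gt0 //; lra.
  rewrite -EFinN -EFinM lee_fin ler_pdivrMr ?ltr0n // mul1r.
  have : (- ln c / delta < n%:R)%R.
    apply: le_lt_trans (ler_norm _) _.
    by apply: lt_le_trans (archi_boundP (normr_ge0 _)) _; rewrite ler_nat.
  rewrite ltr_pdivrMr // /delta mulrDr mulr1 -(natr1 n); move: (lowln n).
  move: (ln (pi _)) (_ * ln _)%R (ln c) => x y w. lra.
rewrite /L_plus_le_rate /L_plus limn_esup_lim; apply: lime_le; first exact: is_cvg_esups.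
near=> n; apply: ub_ereal_sup => _ [m /= nm <-]; rewrite rmorph1.
have : (M < m)%N by apply: leq_trans nm; near: n; exists M.+1.
by case: m {nm} => // m Mm; apply: bd.
Unshelve. all: by end_near.
Qed.

(** For [n >= 1] the state [v n] has stationary mass 0, whose log is minus infinity. *)
Lemma rate_unreachable (C : set (state d)) : C 0%R ->
  (forall q, C q -> C (sim_step q)) -> (forall q, C q -> C (drain_step q)) ->
  (forall n, ~ C (axis_state n.+1)) ->
  ~ L_minus_le_rate R machine /\ ~ L_plus_le_rate R machine.
Proof.
move=> C0 Ca Cb Cgoal; have piP := pi_invariant.
suff Lm : ~ L_minus_le_rate R machine.
  by split => // Lp; apply: Lm; apply: le_trans Lp; apply: limn_einf_sup.
have inf n : log_rate R machine n.+1 = +oo%E.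
  rewrite /log_rate dir_mulrn.
  have -> : @stationary R machine (axis_state n.+1) = 0%R.
    exact: (invariant_closed total_drain drain0 piP C0 Ca Cb (Cgoal n)).
  by rewrite /= lexx /= gt0_mulye // lte_fin invr_gt0 ltr0n.
have cv : (log_rate R machine @ \oo --> +oo%E)%classic.
  by apply: cvg_near_cst; exists 1%N => // -[//|n] _; apply: inf.
rewrite /L_minus_le_rate /L_minus (cvg_limn_einf_sup cv).1 leye_eq; exact/eqP.
Qed.
End Rates.
End MachineWalk.

(** * Running a program on the walk *)

Fixpoint cmd_size c := match c with
  | Skip => 0
  | Inc _ | Dec _ => 1
  | Seq c1 c2 => cmd_size c1 + cmd_size c2
  | While _ c => (cmd_size c).+2
  end.

(** The command occupies the positions from [e + 1] on and leaves at [e].  As positions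
are run downwards, the list starts with the last instruction. *)
Fixpoint flatten_cmd c e : seq instr := match c with
  | Skip => [::]
  | Inc r => [:: INC r]
  | Dec r => [:: DEC r]
  | Seq c1 c2 => flatten_cmd c2 e ++ flatten_cmd c1 (e + cmd_size c2)
  | While r c => JMP (e + cmd_size c).+2 :: rcons (flatten_cmd c e.+1) (JZ r e)
  end.

Lemma size_flatten_cmd c e : size (flatten_cmd c e) = cmd_size c.
Proof.
elim: c e => //= [c1 IH1 c2 IH2|r c IH] e; first by rewrite size_cat IH1 IH2 addnC.
by rewrite size_rcons IH.
Qed.

Fixpoint all_regs (P : pred nat) c := match c with
  | Skip => true
  | Inc r | Dec r => P r
  | Seq c1 c2 => all_regs P c1 && all_regs P c2
  | While r c => P r && all_regs P c
  end.

Lemma all_regsW (P Q : pred nat) c : (forall r, P r -> Q r) -> all_regs P c -> all_regs Q c.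
Proof.
move=> PQ; elim: c => //= [c1 IH1 c2 IH2|r c IH].
  by move=> /andP[/IH1-> /IH2->].
by move=> /andP[/PQ-> /IH->].
Qed.

Lemma all_regsI (P Q : pred nat) c :
  all_regs (fun r => P r && Q r) c = all_regs P c && all_regs Q c.
Proof. by elim: c => //= [c1 -> c2 ->|r c ->]; rewrite andbACA. Qed.

Lemma all_regs_bound c : exists K, all_regs (gtn K) c.
Proof.
elim: c => /= [|r|r|c1 [K1 H1] c2 [K2 H2]|r c [K H]];
    [by exists 0|by exists r.+1|by exists r.+1| |].
  exists (maxn K1 K2); apply/andP; split;
      [apply: all_regsW H1|apply: all_regsW H2] => r /=; lia.
by exists (maxn r.+1 K); apply/andP; split; [rewrite /=; lia|apply: all_regsW H => q /=; lia].
Qed.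

Lemma all_regs_seqs P s : all_regs P (seqs s) = all (all_regs P) s.
Proof. by elim: s => //= c s ->. Qed.

Lemma all_regs_compile (P : pred nat) n (f : recfun n) args out b :
  P 0 -> all P args -> P out -> (forall r, b <= r -> P r) -> all_regs P (compile f args out b).
Proof.
move=> P0.
elim: f args out b => {n} [n||n i|n k g IHg h IHh|n g IHg h IHh|n g IHg] args out b Pargs
    Pout Pb //=.
- have Pa i : P (nth 0 args i).
    by have [lt|ge] := ltnP i (size args);
        [exact: (allP Pargs _ (mem_nth _ lt))|rewrite nth_default].
  by rewrite !Pa Pout Pb.
- have Pa j : P (nth 0 args j).
    by have [lt|ge] := ltnP j (size args);
        [exact: (allP Pargs _ (mem_nth _ lt))|rewrite nth_default].
  by rewrite !Pa Pout Pb.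
- rewrite !all_regs_seqs !all_map; apply/and3P; split.
  + by apply/allP => i _ /=; apply: IHh => //; [apply: Pb; lia|move=> r rb; apply: Pb; lia].
  + apply: IHg => //; last by move=> r rb; apply: Pb; lia.
    by apply/allP => r; rewrite mem_iota => /andP[/Pb].
  + by apply/allP => i _ /=; rewrite Pb //; lia.
- have Pa j : P (nth 0 args j).
    by have [lt|ge] := ltnP j (size args);
        [exact: (allP Pargs _ (mem_nth _ lt))|rewrite nth_default].
  have Pba : all P (behead args) by case: args Pargs {Pa} => //= a args /andP[].
  rewrite Pa Pout !Pb ?IHg ?IHh //=; try lia.
  + by rewrite !Pb //; lia.
  + by apply: Pb; lia.
  + by move=> r rb; apply: Pb; lia.
  + by apply: Pb; lia.
  + by move=> r rb; apply: Pb; lia.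
by rewrite Pout !Pb ?IHg //= ?Pout ?Pb // => r rb; apply: Pb; lia.
Qed.

(** A safe instruction leads from a program position to a program position and does not
touch register 1; so register 1 is filled only by the end of the program. *)
Definition instr_safe K d0 (c : instr) : bool :=
  match c with
  | INC r | DEC r => (r < K) && (r != 1)
  | JZ r t => (r < K) && (K <= t < d0)
  | JMP t => K <= t < d0
  end.

Lemma flatten_cmd_safe K d0 c e : all_regs (fun r => (r < K) && (r != 1)) c ->
  K <= e -> e + cmd_size c < d0 -> all (instr_safe K d0) (flatten_cmd c e).
Proof.
elim: c e => //= [r|r|c1 IH1 c2 IH2|r c IH] e; rewrite ?andbT //.
  by move=> /andP[r1 r2] Ke ed; rewrite all_cat IH1 ?IH2 //; lia.
by move=> /andP[/andP[r1 _] r2] Ke ed; rewrite all_rcons /= r1 IH //; lia.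
Qed.

Section Simulation.
Variables (K : nat) (c0 : cmd) (k : nat).
Let prog := flatten_cmd c0 K.
Let d0 := core_dim K prog.
Let d := d0 + k.
Local Notation step := (@sim_step K prog k).
Local Notation instr_at := (instr_at K prog).

Lemma d0E : d0 = (K + cmd_size c0).+1. Proof. by rewrite /d0 /core_dim size_flatten_cmd. Qed.

Definition config j (u : store) : state d :=
  [ffun i : 'I_d => if i < K then u i else nat_of_bool (i == j :> nat)].

Lemma top_config j u : K <= j -> j < d ->
  has (active (face (config j u))) (iota 0 d) /\
  top d (active (face (config j u))) = j.
Proof.
move=> Kj jd; have act (i : 'I_d) := active_face (config j u) i.
have aj : active (face (config j u)) j.
  by have -> := act (Ordinal jd); rewrite ffunE /= [j < K]ltnNge Kj eqxx.
split; first by apply/hasP; exists j => //; rewrite mem_iota.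
apply: topE => // i id; have -> := act (Ordinal id); rewrite ffunE /=.
by case: ifP => [iK _|_]; [lia|case: eqP => [->|]].
Qed.

Lemma active_config j u r : r < K -> active (face (config j u)) r = (0 < u r).
Proof.
move=> rK; have rd : r < d by rewrite /d d0E; lia.
by rewrite -[r in LHS]/(val (Ordinal rd)) active_face ffunE /= rK.
Qed.

Lemma sim_config j u : K <= j -> j < d ->
  sim K prog k (active (face (config j u))) =
  match instr_at j with
  | INC r => ([:: j.-1; r], [:: j])
  | DEC r => ([:: j.-1], if active (face (config j u)) r then [:: j; r] else [:: j])
  | JZ r t => ([:: if active (face (config j u)) r then j.-1 else t], [:: j])
  | JMP t => ([:: t], [:: j])
  end.
Proof.
move=> Kj jd; have [hP tE] := top_config u Kj jd.
by rewrite /sim -/d0 -/d hP tE /= [j < K]ltnNge Kj.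
Qed.

Ltac config_eq := case: ifP => iK; do !(case: eqP => [?|?] //=); subst; lia.

Lemma step_inc j u r : K < j -> j < d -> r < K -> instr_at j = INC r ->
  step (config j u) = config j.-1 (upd u r (u r).+1).
Proof.
move=> Kj jd rK E; apply/ffunP => -[i id];
    rewrite ffunE sim_config ?(ltnW Kj) // E /= !inE !ffunE /upd; rewrite /=; config_eq.
Qed.

Lemma step_dec j u r : K < j -> j < d -> r < K -> instr_at j = DEC r ->
  step (config j u) = config j.-1 (upd u r (u r).-1).
Proof.
move=> Kj jd rK E; apply/ffunP => -[i id]; rewrite ffunE sim_config ?(ltnW Kj) // E /=.
rewrite active_config //; case: ifP => ur; rewrite /= !inE !ffunE /upd; rewrite /=; config_eq.
Qed.

Lemma step_jz j u r t : K < j -> j < d -> r < K -> K <= t -> instr_at j = JZ r t ->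
  step (config j u) = config (if u r == 0 then t else j.-1) u.
Proof.
move=> Kj jd rK Kt E; apply/ffunP => -[i id]; rewrite ffunE sim_config ?(ltnW Kj) // E /=.
rewrite active_config // lt0n; case: (u r == 0); rewrite /= !inE !ffunE; rewrite /=; config_eq.
Qed.

Lemma step_jmp j u t : K < j -> j < d -> K <= t -> instr_at j = JMP t ->
  step (config j u) = config t u.
Proof.
move=> Kj jd Kt E; apply/ffunP => -[i id]; rewrite ffunE sim_config ?(ltnW Kj) // E /=.
rewrite /= !inE !ffunE; rewrite /=; config_eq.
Qed.

Definition code_at e s := forall i, i < size s -> instr_at (e.+1 + i) = nth (JMP 1) s i.

Lemma code_at_cat e s1 s2 : code_at e (s1 ++ s2) ->
  code_at e s1 /\ code_at (e + size s1) s2.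
Proof.
move=> H; split => i lt.
  by rewrite H ?nth_cat ?lt // size_cat ltn_addr.
rewrite -addSn -addnA H ?size_cat ?ltn_add2l // nth_cat ltnNge leq_addr /=.
by rewrite addKn.
Qed.

Lemma code_at_cons e x s : code_at e (x :: s) -> code_at e.+1 s.
Proof. by move=> H i lt; have := H i.+1 lt; rewrite addnS. Qed.

Lemma code_at_rcons e x s : code_at e (rcons s x) -> code_at e s.
Proof. by rewrite -cats1 => /code_at_cat[]. Qed.

Lemma simulation c e u v : exec c u v -> all_regs (gtn K) c -> K <= e -> e + cmd_size c < d ->
  code_at e (flatten_cmd c e) -> exists n, iter n step (config (e + cmd_size c) u) = config e v.
Proof.
move=> ex; elim: ex e => {c u v} [u|r u|r u|c1 c2 u v w ex1 IH1 ex2 IH2|r c u u0|r c u v w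
    u0 ex1 IH1 ex2 IH2] e /=.
- by exists 0; rewrite addn0.
- move=> rK Ke ed /(_ 0 isT); rewrite addn0 addn1 => E; exists 1.
  by rewrite /= (step_inc _ _ _ rK E) //; lia.
- move=> rK Ke ed /(_ 0 isT); rewrite addn0 addn1 => E; exists 1.
  by rewrite /= (step_dec _ _ _ rK E) //; lia.
- move=> /andP[rc1 rc2] Ke ed /code_at_cat[C2 C1]; rewrite size_flatten_cmd in C1.
  have [n1 E1] := IH1 (e + cmd_size c2) rc1 ltac:(lia) ltac:(lia) C1.
  have [n2 E2] := IH2 e rc2 Ke ltac:(lia) C2.
  by exists (n2 + n1); rewrite iterD [cmd_size c1 + _]addnC addnA E1.
- move=> /andP[rK rc] Ke ed C; exists 1.
  have := C (cmd_size c).+1; rewrite /= size_rcons size_flatten_cmd ltnS => /(_ (leqnn _)).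
  rewrite nth_rcons size_flatten_cmd ltnn eqxx addSnnS => E.
  by rewrite /= (step_jz _ _ _ rK Ke E) ?u0 //; lia.
move=> /andP[rK rc] Ke ed C.
have E := C (cmd_size c).+1; rewrite /= size_rcons size_flatten_cmd ltnS in E.
move/(_ (leqnn _)): E; rewrite nth_rcons size_flatten_cmd ltnn eqxx addSnnS => E.
have E0 : instr_at e.+1 = JMP (e + cmd_size c).+2 by have := C 0 isT; rewrite addn0.
have [n1 E1] := IH1 e.+1 rc (leqW Ke) ltac:(lia) (code_at_rcons (code_at_cons C)).
have [n2 E2] := IH2 e ltac:(by rewrite /= rK rc) Ke ed C.
exists (n2 + (n1.+1).+1); rewrite iterD iterSr iterS.
rewrite (step_jz _ _ _ rK Ke E) ?(negPf u0); try lia.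
have -> : (e + (cmd_size c).+2).-1 = e.+1 + cmd_size c by lia.
rewrite E1 (step_jmp _ _ _ _ E0); try lia.
by rewrite -[RHS]E2 /= !addnS.
Qed.

Lemma code_at_prog : code_at K prog.
Proof.
move=> i lt; have id : K.+1 + i < d0 by rewrite d0E -(size_flatten_cmd c0 K) /prog in lt *; lia.
rewrite /instr_at -/d0 id; have -> : K.+1 + i - K = i.+1 by lia.
by [].
Qed.

Lemma len_gt_prog : K < d0. Proof. by rewrite d0E ltnS leq_addr. Qed.

Lemma step0 : step 0%R = config d.-1 (fun=> 0).
Proof.
have zero i : active (face (0%R : state d)) i = false.
  case E: (active _ _) => //; have id := active_lt E.
  by move: E; rewrite -[i]/(val (Ordinal id)) active_face ffunE.
have nhas : has (active (face (0%R : state d))) (iota 0 d) = false.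
  by apply/hasP => -[i _]; rewrite zero.
apply/ffunP => -[i id]; rewrite !ffunE /sim -/d0 -/d nhas /= inE subn0 add0n.
case: ifP => // iK; have := len_gt_prog; rewrite /d; case: eqP => //; lia.
Qed.

Hypothesis K2 : 1 < K.

(** The positions above the program increment register 0 one by one. *)
Lemma load m : m <= k ->
  iter m.+1 step 0%R = config (d.-1 - m) (upd (fun=> 0) 0 m).
Proof.
have Kd0 := len_gt_prog.
elim: m => [|m IHm] mk.
  rewrite /= step0 subn0; congr config; apply: funext => r.
  by rewrite /upd; case: eqP.
rewrite iterS (IHm (ltnW mk)) (@step_inc _ _ 0); try (rewrite /d; lia).
  rewrite subnS; congr config; apply: funext => r; rewrite /upd eqxx.
  by case: eqP.
by rewrite /instr_at -/d0 ltnNge; have -> : d0 <= d.-1 - m by rewrite /d; lia.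
Qed.

Lemma load_end : iter k.+1 step 0%R = config (K + cmd_size c0) (upd (fun=> 0) 0 k).
Proof.
rewrite load //; congr config.
by have := d0E; rewrite /d; lia.
Qed.

Lemma step_halt u : (forall r, u r = 0) -> step (config K u) = axis_state K prog k 1.
Proof.
move=> u0; apply/ffunP => -[i id]; rewrite ffunE sim_config //; last first.
  by rewrite /d d0E; lia.
rewrite /instr_at -/d0 len_gt_prog subnn /= !inE !ffunE /= u0.
by case: ifP => iK; do !(case: eqP => [?|?] //=); subst; lia.
Qed.

Definition regs_only (q : state d) := forall i : 'I_d, K <= i -> q i = 0.

(** The register that grows was positive already, so an empty register stays empty. *)
Lemma step_regs_only q : regs_only q -> q != 0%R ->
  exists2 j : 'I_d, 0 < q j & step q = [ffun i => q i + (i == j)].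
Proof.
move=> qK q0.
have hP : has (active (face q)) (iota 0 d).
  rewrite has_active; apply: contra_neqT q0 => /negPn/eqP f0; apply/ffunP => i.
  rewrite [RHS]ffunE; apply/eqP; rewrite -leqn0 leqNgt; apply/negP => qi.
  have : i \in face q by rewrite inE.
  by rewrite f0 inE.
have [jd qj _] := topP hP; exists (Ordinal jd).
  by rewrite -active_face.
have jK : top d (active (face q)) < K.
  rewrite ltnNge; apply/negP => Kj; move: qj.
  by rewrite -[top _ _]/(val (Ordinal jd)) active_face qK.
apply/ffunP => i; rewrite !ffunE /sim -/d0 -/d hP /= jK /= inE subn0.
by rewrite -val_eqE.
Qed.

Lemma regs_only_iter n q : regs_only q -> q != 0%R ->
  regs_only (iter n step q) /\ iter n step q != 0%R.
Proof.
move=> qK q0; elim: n => // n [iK i0] /=.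
have [j qj ->] := step_regs_only iK i0.
have jK : j < K by rewrite ltnNge; apply/negP => /iK; lia.
split; first by move=> i Ki; rewrite ffunE iK //; case: eqP => // ij; subst i; lia.
by apply/negP => /eqP/ffunP/(_ j); rewrite !ffunE eqxx; lia.
Qed.

Hypothesis c0_regs : all_regs (fun r => (r < K) && (r != 1)) c0.

Lemma run v : exec c0 (upd (fun=> 0) 0 k) v ->
  exists N, iter N step 0%R = config K v.
Proof.
move=> ex.
have [||||n E] := @simulation c0 K _ _ ex; [| by [] | | |].
- by apply: all_regsW c0_regs => r /andP[].
- by rewrite /d d0E; lia.
- exact: code_at_prog.
by exists (n + k.+1); rewrite iterD load_end.
Qed.

Lemma halting_rate (R : realType) v : exec c0 (upd (fun=> 0) 0 k) v ->
  (forall r, v r = 0) ->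
  L_minus_le_rate R (machine K prog k) /\ L_plus_le_rate R (machine K prog k).
Proof.
move=> ex v0; have [N E] := run ex.
by apply: (@rate_reachable _ _ _ _ N.+1) => //=; rewrite E step_halt.
Qed.

Lemma instr_at_safe j : K < j -> instr_safe K d0 (instr_at j).
Proof.
move=> Kj; rewrite /instr_at -/d0; case: ifP => jd; last by rewrite /=; lia.
have -> : j - K = (j - K.+1).+1 by lia.
have /(all_nthP (JMP 1)) := @flatten_cmd_safe K d0 c0 K c0_regs (leqnn K) ltac:(by rewrite d0E).
by apply; rewrite size_flatten_cmd; have := d0E; lia.
Qed.

Lemma step_config j u : K < j -> j < d -> u 1 = 0 ->
  exists j' u', [/\ step (config j u) = config j' u', K <= j', j' < d & u' 1 = 0].
Proof.
move=> Kj jd u1; have := instr_at_safe Kj; have d0d : d0 <= d by rewrite /d leq_addr.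
case E: (instr_at j) => [r|r|r t|t] /=.
- move=> /andP[rK r1]; rewrite (step_inc _ Kj jd rK E).
  exists j.-1, (upd u r (u r).+1); split=> //; try lia.
  by rewrite /upd eq_sym (negPf r1).
- move=> /andP[rK r1]; rewrite (step_dec _ Kj jd rK E).
  exists j.-1, (upd u r (u r).-1); split=> //; try lia.
  by rewrite /upd eq_sym (negPf r1).
- move=> /and3P[rK Kt td]; rewrite (step_jz _ Kj jd rK Kt E).
  by exists (if u r == 0 then t else j.-1), u; split=> //; case: ifP => _; lia.
move=> /andP[Kt td]; rewrite (step_jmp _ Kj jd Kt E).
by exists t, u; split=> //; lia.
Qed.

Lemma step_config_halt u : regs_only (step (config K u)) /\ step (config K u) != 0%R.
Proof.
have Kd : K < d by rewrite /d; have := len_gt_prog; lia.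
have E (i : 'I_d) : step (config K u) i =
    (if i < K then u i + (i == 1 :> nat) else 0).
  case: i => i id; rewrite ffunE sim_config // /instr_at -/d0 len_gt_prog subnn /= !inE
      !ffunE /=.
  config_eq.
split; first by move=> i Ki; rewrite E ltnNge Ki.
have d1 : 1 < d by lia.
by apply/negP => /eqP/ffunP/(_ (Ordinal d1)); rewrite E ffunE /= K2 addn1.
Qed.

Section Loop.
Variables (N j1 : nat) (u1 : store).
Hypotheses (Kj1 : K <= j1) (j1d : j1 < d).
Hypothesis reach : iter N step 0%R = config j1 u1.
Hypothesis loop : step (step (config j1 u1)) = config j1 u1.

Lemma reach_loop m : iter (m.*2 + N) step 0%R = config j1 u1.
Proof.
elim: m => [|m IHm]; first by rewrite double0 add0n reach.
by rewrite doubleS !addSn !iterS IHm loop.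
Qed.

(** A run that has come to the end of the program consists of registers only from then
on, and could not come back to the loop. *)
Lemma trajectory n : exists j u,
  [/\ iter n.+1 step 0%R = config j u, K < j, j < d & u 1 = 0].
Proof.
have strict j u m : iter m step 0%R = config j u -> K <= j -> K < j.
  move=> E Kj; rewrite ltn_neqAle Kj andbT; apply/eqP => jK; subst j.
  have [r0 nz] := step_config_halt u.
  have [] := regs_only_iter (m.+1.*2 + N - m.+1) r0 nz.
  rewrite -E -iterS -iterD subnK; last by rewrite -addnn; lia.
  rewrite reach_loop => /(_ (Ordinal j1d) Kj1).
  by rewrite ffunE /= ltnNge Kj1 eqxx.
elim: n => [|n [j [u [E Kj jd u0]]]].
  have Kd := len_gt_prog; exists d.-1, (fun=> 0).
  split; [exact: step0| |by rewrite /d; lia|by []].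
  by apply: (strict _ (fun=> 0) 1 step0); rewrite /d; lia.
have [j' [u' [E' Kj' j'd u'0]]] := step_config Kj jd u0.
by exists j', u'; split=> //; [rewrite iterS E | apply: (strict j' u' n.+2) => //;
    rewrite iterS E].
Qed.

(** The closed set consists of the states of the run and the states made of registers
only, all with register 1 empty.  It is closed under draining because a run has its
program position at 1, which draining removes. *)
Lemma looping_rate (R : realType) :
  ~ L_minus_le_rate R (machine K prog k) /\ ~ L_plus_le_rate R (machine K prog k).
Proof.
pose C (q : state d) := (forall i : 'I_d, i = 1 :> nat -> q i = 0) /\
  (regs_only q \/ exists n, q = iter n step 0%R).
have tC n : C (iter n step 0%R).
  split; last by right; exists n.
  case: n => [|n] i i1; first by rewrite ffunE.
  have [j [u [-> Kj jd u0]]] := trajectory n.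
  by rewrite ffunE i1 K2.
apply: (@rate_unreachable K prog k R C).
- exact: (tC 0).
- move=> q [q1 [rq|[n ->]]]; last exact: (tC n.+1).
  have [->|q0] := eqVneq q 0%R; first exact: (tC 1).
  have [j qj E] := step_regs_only rq q0.
  have [r' _] := regs_only_iter 1 rq q0.
  split; last by left.
  move=> i i1; rewrite E ffunE q1 //; case: eqP => // ij; subst i.
  by rewrite (q1 j) in qj.
- move=> q [q1 qC]; split; first by move=> i i1; rewrite ffunE q1.
  left=> i Ki; rewrite ffunE; case: qC => [rq|[[|n] ->]]; first by rewrite rq.
    by rewrite ffunE.
  have [j [u [-> Kj jd _]]] := trajectory n.
  by rewrite ffunE ltnNge Ki /=; case: eqP.
have d1 : 1 < d by have := len_gt_prog; rewrite /d; lia.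
by move=> n [/(_ (Ordinal d1) erefl)]; rewrite ffunE.
Qed.
End Loop.
End Simulation.

(** * The code of an instance as a recursive function *)

Definition code_head s := logn 2 s.
Definition code_tail s := s %/ 2 ^ code_head s %/ 2.
Definition code_nth s i := code_head (iteri i (fun _ u => code_tail u) s).

Lemma code_head_cons n l : code_head (CodeSeq.code (n :: l)) = n.
Proof.
rewrite /code_head /= lognM ?expn_gt0 // pfactorK // logn_coprime ?addn0 //.
by rewrite coprime2n /= odd_double.
Qed.

Lemma code_tail_cons n l : code_tail (CodeSeq.code (n :: l)) = CodeSeq.code l.
Proof.
rewrite /code_tail code_head_cons /= mulKn ?expn_gt0 // divn2 -[_.*2.+1]/(true + _.*2).
by rewrite half_bit_double.
Qed.

Lemma code_nthE l i : code_nth (CodeSeq.code l) i = nth 0 l i.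
Proof.
have itS k u : iteri k.+1 (fun _ u => code_tail u) u = iteri k (fun _ => code_tail)
    (code_tail u).
  by elim: k => //= k <-.
rewrite /code_nth; elim: i l => [|i IHi] [|n l]; rewrite ?code_head_cons ?nth_nil // itS.
  by have := IHi [::]; rewrite nth_nil.
by rewrite code_tail_cons IHi.
Qed.

Lemma rec1_code_head : rec1 code_head.
Proof.
suff : rec1 (fun s => \sum_(i < s) (2 ^ i.+1 %| s)).
  move/eq_recursive; apply => x; rewrite /code_head; move: (nth 0 x 0) => s.
  case: s => [|s]; first by rewrite big_ord0.
  rewrite big_ord_recr /= logn_count_dvd // big_add1 /= big_mkord.
  by rewrite [2 ^ _ %| _]gtnNdvd ?addn0 // ltn_expl.
apply: (@recursive_sum 1 (fun i x => 2 ^ i.+1 %| nth 0 x 0)); recsolve.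
Qed.
#[local] Hint Resolve rec1_code_head : rec.

Lemma rec1_code_tail : rec1 code_tail.
Proof. rewrite /rec1 /code_tail; recsolve. Qed.
#[local] Hint Resolve rec1_code_tail : rec.

Lemma rec2_code_nth : rec2 code_nth.
Proof. rewrite /rec2 /code_nth; recsolve. Qed.
#[local] Hint Resolve rec2_code_nth : rec.

Definition bit A i := odd (A %/ 2 ^ i).

Lemma rec2_bit : rec2 bit.
Proof. rewrite /rec2 /bit; recsolve. Qed.
#[local] Hint Resolve rec2_bit : rec.

Definition ones n := \sum_(i < n) 3 ^ i.
Definition bitern n A := \sum_(i < n) bit A i * 3 ^ i.

Lemma rec1_ones : rec1 ones.
Proof. rewrite /rec1 /ones; apply: (@recursive_sum 1 (fun i x => 3 ^ i)); recsolve. Qed.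
#[local] Hint Resolve rec1_ones : rec.

Lemma rec2_bitern : rec2 bitern.
Proof.
rewrite /rec2 /bitern.
apply: (@recursive_sum 2 (fun i x => bit (nth 0 x 1) i * 3 ^ i)); recsolve.
Qed.
#[local] Hint Resolve rec2_bitern : rec.

Definition topb n A := top n (bit A).

Lemma rec2_topb : rec2 topb.
Proof. rewrite /rec2 /topb /top; recsolve. Qed.
#[local] Hint Resolve rec2_topb : rec.

Section Entries.
Variables s A B : nat.
Let d0 := code_head s.
Let d := d0 + s.

(** The number [B] of a move, its ternary digits being those of the move, is determined
by [B + (sum of 3 ^ i over the coordinates that go down) =
ones d + (sum of 3 ^ i over the coordinates that go up)].  The three cases are the
origin, the faces of the table and the faces with an extra position.  For a face of
the table all digits of [B] from the place [d0] on are 1, so that [B] exceeds the entry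
by [ones d - ones d0].  [s] codes the
dimension [d0] of the table followed by its entries, which are the numbers of moves
in dimension [d0], and is itself the number of extra positions. *)
Definition is_sim_number :=
  if A == 0 then B == ones d + 3 ^ d.-1
  else if A < 2 ^ d0 then B + ones d0 == ones d + code_nth s A.+1
  else B + 3 ^ topb d A == ones d + (3 ^ (topb d A).-1 + 1).
Definition is_drain_number := B + bitern d A == ones d.

(** If the two moves coincided, the probability would be 4/9 + 5/9 = 1. *)
Definition entry_num := if is_sim_number then (if is_drain_number then 1 else 4) else (if
    is_drain_number then 5 else 0).
Definition entry_den := if is_sim_number then (if is_drain_number then 1 else 9) else (if
    is_drain_number then 9 else 1).
End Entries.

Lemma recursive_is_sim_number n S A B : recursive n S -> recursive n A -> recursive n B ->
  recursive n (fun x => nat_of_bool (is_sim_number (S x) (A x) (B x))).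
Proof.
suff r : rec3 (fun s A B =>
  if A == 0 then nat_of_bool (B == ones (code_head s + s) + 3 ^ (code_head s + s).-1)
  else if A < 2 ^ code_head s
    then nat_of_bool (B + ones (code_head s) == ones (code_head s + s) + code_nth s A.+1)
  else nat_of_bool (B + 3 ^ topb (code_head s + s) A
                    == ones (code_head s + s) + (3 ^ (topb (code_head s + s) A).-1 + 1))).
  move=> rS rA rB; apply: eq_recursive (recursive3 r rS rA rB) _ => x.
  by rewrite /is_sim_number; do !case: ifP.
rewrite /rec3 /=; recsolve.
Qed.

Lemma rec3_is_sim_number : rec3 (fun s A B => nat_of_bool (is_sim_number s A B)).
Proof. apply: recursive_is_sim_number; recsolve. Qed.

Lemma rec3_is_drain_number : rec3 (fun s A B => nat_of_bool (is_drain_number s A B)).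
Proof. rewrite /rec3 /is_drain_number; recsolve. Qed.

Lemma rec3_entry_num : rec3 entry_num.
Proof.
rewrite /rec3 /entry_num.
do !(apply: recursive_if; first by [exact: rec3_is_sim_number | exact: rec3_is_drain_number]);
  recsolve.
Qed.
#[local] Hint Resolve rec3_entry_num : rec.

Lemma rec3_entry_den : rec3 entry_den.
Proof.
rewrite /rec3 /entry_den.
do !(apply: recursive_if; first by [exact: rec3_is_sim_number | exact: rec3_is_drain_number]);
  recsolve.
Qed.
#[local] Hint Resolve rec3_entry_den : rec.

(** Rationals are listed as sign, numerator and denominator, faces being the outer and
moves the inner index. *)
Definition prob_entry s i :=
  if i %% 3 == 0 then 0
  else if i %% 3 == 1
    then entry_num s (i %/ 3 %/ 3 ^ (code_head s + s)) (i %/ 3 %% 3 ^ (code_head s + s))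
  else entry_den s (i %/ 3 %/ 3 ^ (code_head s + s)) (i %/ 3 %% 3 ^ (code_head s + s)).

Lemma rec2_prob_entry : rec2 prob_entry.
Proof. rewrite /rec2 /prob_entry; recsolve. Qed.
#[local] Hint Resolve rec2_prob_entry : rec.

Lemma recursive_behead2 n F :
  recursive n F -> recursive n.+2 (fun y => F (behead (behead y))).
Proof.
move=> /(recursive_env n.+2 (fun i => i.+2)) rF; apply: eq_recursive_size rF _.
move=> [|a [|b x]] //= [<-]; congr F.
by rewrite -[RHS](mkseq_nth 0).
Qed.

(** The list is coded from its end: the code of [n :: l] is
[2 ^ n * (2 * code l).+1]. *)
Lemma recursive_code_map n (F : nat -> seq nat -> nat) N l :
  recursive n.+2 (fun y => F (nth 0 y 0) (behead (behead y))) ->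
  recursive n N -> recursive n (fun x => CodeSeq.code (l x)) ->
  recursive n (fun x => CodeSeq.code ([seq F i x | i <- iota 0 (N x)] ++ l x)).
Proof.
move=> rF rN rl.
pose G m a x := 2 ^ F (N x - m.+1) x * (2 * a).+1.
suff : recursive n (fun x => iteri (N x) (fun m a => G m a x) (CodeSeq.code (l x))).
  move/eq_recursive; apply => x.
  suff E m : m <= N x -> iteri m (fun m a => G m a x) (CodeSeq.code (l x)) =
      CodeSeq.code ([seq F i x | i <- iota (N x - m) m] ++ l x).
    by rewrite E // subnn.
  elim: m => [|m IHm] le_mN //=; rewrite IHm ?(ltnW le_mN) // /G mul2n subnSK //.
apply: recursive_iteri => //; rewrite /G.
apply: (recursive2 rec2_mul); last by recsolve.
apply: (recursive2 rec2_exp); first by recsolve.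
pose H i := if i is j.+2 then nth 0 ^~ j.+2 else
  if i is 1 then nth 0 ^~ 1 else
  fun y : seq nat => N (behead (behead y)) - (nth 0 y 0).+1.
have rH i : i < n.+2 -> recursive n.+2 (H i).
  case: i => [|[|i]] _ /=; try by exact: recursive_var.
  by apply: (recursive2 rec2_sub); [exact: recursive_behead2 | recsolve].
apply: eq_recursive_size (recursive_comp rF rH) _ => -[|a [|b x]] //= [<-].
congr F; rewrite (iotaDl 2 0) -map_comp -[RHS](mkseq_nth 0).
exact: eq_map.
Qed.

(** The direction is the coordinate 1; the weights and the threshold are equal to 1,
and so they contribute [d + 1] times the triple 0, 1, 1. *)
Definition instance_code s :=
  let d := code_head s + s in
  CodeSeq.code (d ::
    [seq prob_entry s i | i <- iota 0 (3 * (2 ^ d * 3 ^ d))] ++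
    [seq nat_of_bool (0 < i %% 3) | i <- iota 0 (3 * d.+1)] ++
    [seq nat_of_bool (i == 1) | i <- iota 0 d]).

Lemma rec1_instance_code : rec1 instance_code.
Proof.
suff : recursive 1 (fun x => let s := nth 0 x 0 in let d := code_head s + s in
  CodeSeq.code ([seq code_head s + s | i <- iota 0 1] ++
    ([seq prob_entry s i | i <- iota 0 (3 * (2 ^ d * 3 ^ d))] ++
    ([seq nat_of_bool (0 < i %% 3) | i <- iota 0 (3 * d.+1)] ++
    ([seq nat_of_bool (i == 1) | i <- iota 0 d] ++ [::]))))).
  by move/eq_recursive; apply => x /=; rewrite cats0.
cbv zeta.
apply: (@recursive_code_map 1 (fun i x => code_head (nth 0 x 0) + nth 0 x 0));
    [recsolve|recsolve|].
apply: (@recursive_code_map 1 (fun i x => prob_entry (nth 0 x 0) i)); [recsolve|recsolve|].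
apply: (@recursive_code_map 1 (fun i x => nat_of_bool (0 < i %% 3))); [recsolve|recsolve|].
apply: (@recursive_code_map 1 (fun i x => nat_of_bool (i == 1))); recsolve.
Qed.

(** * The code of the walk of a program on its own table *)

Lemma sum_digits b n B : \sum_(i < n) (B %/ b ^ i %% b) * b ^ i = B %% b ^ n.
Proof.
elim: n => [|n IHn]; first by rewrite big_ord0 modn1.
rewrite big_ord_recr /= IHn modn_divl -expnS [RHS](divn_eq _ (b ^ n)) addnC.
by rewrite modn_dvdm // dvdn_exp2l.
Qed.

Lemma flatten_mkseq T (f : nat -> nat -> T) a b :
  flatten [seq mkseq (f k) b | k <- iota 0 a] =
  mkseq (fun i => f (i %/ b) (i %% b)) (a * b).
Proof.
elim: a => [|a IHa]; first by [].
rewrite -addn1 iotaD map_cat flatten_cat IHa /= cats0 add0n mulnDl mul1n.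
rewrite /mkseq iotaD map_cat add0n; congr cat.
have -> : iota (a * b) b = [seq a * b + i | i <- iota 0 b] by rewrite -iotaDl addn0.
rewrite -map_comp; apply/eq_in_map => i.
rewrite mem_iota /= => ib.
by rewrite divnMDl ?modnMDl ?(modn_small ib) ?(divn_small ib) ?addn0 //; lia.
Qed.

Lemma bit_ge d A i : A < 2 ^ d -> d <= i -> bit A i = false.
Proof.
move=> Ad di; rewrite /bit divn_small //.
by apply: leq_trans Ad _; rewrite leq_exp2l.
Qed.

Lemma bit_sum n A : \sum_(i < n) bit A i * 2 ^ i = A %% 2 ^ n.
Proof. by rewrite -sum_digits; apply: eq_bigr => i _; rewrite modn2. Qed.

Lemma has_bit d A : A < 2 ^ d -> has (bit A) (iota 0 d) = (A != 0).
Proof.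
move=> Ad; apply/hasP/idP => [[i _]|]; first by apply: contraTneq => ->; rewrite /bit div0n.
apply: contraNP => H; rewrite -(modn_small Ad) -bit_sum big1 // => i _.
case bi: (bit A i) => //; case: H; exists (val i) => //; rewrite mem_iota /= add0n;
    exact: ltn_ord.
Qed.

Lemma active_nth_face d A : A < 2 ^ d -> active (nth_face d A) = bit A.
Proof.
move=> Ad; apply: funext => i; have [id|di] := ltnP i d.
  by rewrite -[i]/(val (Ordinal id)) activeE inE.
rewrite (bit_ge Ad di); by case E: (active _ i) => //; have := active_lt E; lia.
Qed.

Definition ternary n (a : pred nat) := \sum_(i < n) a i * 3 ^ i.

Lemma nth_move_ternary d B : B < 3 ^ d -> \sum_(i < d) nth_move d B i * 3 ^ i = B.
Proof.
move=> Bd; rewrite -[RHS](modn_small Bd) -sum_digits; apply: eq_bigr => i _.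
by rewrite ffunE inordK ?ltn_pmod.
Qed.

(** Subtraction of digits is avoided by moving the coordinates that go down to the
other side. *)
Lemma nth_move_mkmove d B (u v : pred nat) : B < 3 ^ d ->
  (nth_move d B == mkmove d u v) = (B + ternary d v == ones d + ternary d u).
Proof.
move=> Bd.
have N : \sum_(i < d) mkmove d u v i * 3 ^ i + ternary d v = ones d + ternary d u.
  rewrite /ternary /ones -!big_split; apply: eq_bigr => i _ /=; rewrite mkmoveE.
  by case: (u i) (v i) => [] [] /=; lia.
apply/eqP/eqP => [E|E]; first by rewrite -N -E nth_move_ternary.
have -> : B = \sum_(i < d) mkmove d u v i * 3 ^ i by apply/eqP;
    rewrite -(eqn_add2r (ternary d v)) E N.
apply/ffunP => i; apply: val_inj.
have lt3 (j : 'I_d) : (mkmove d u v j < 3)%N by [].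
by rewrite ffunE /= inordK ?ltn_pmod //; have [_ ->] := digit_sum i lt3.
Qed.

Lemma ternary_mem d (s : seq nat) : uniq s -> all (gtn d) s ->
  ternary d (mem s) = \sum_(i <- s) 3 ^ i.
Proof.
rewrite /ternary; elim: s => [|x s IHs] /=; first by rewrite big_nil big1.
move=> /andP[xs us] /andP[xd sd]; rewrite big_cons -IHs //.
rewrite (eq_bigr (fun i : 'I_d => (val i == x) * 3 ^ i + (val i \in s) * 3 ^ i)).
  rewrite big_split /=; congr addn.
  rewrite (bigD1 (Ordinal xd)) //= eqxx mul1n big1 ?addn0 // => i.
  by rewrite -val_eqE /= => /negPf->.
move=> i _; rewrite -mulnDl; congr muln; rewrite -[LHS]/(nat_of_bool (val i \in x :: s)) inE.
by have [->|] := eqVneq (val i) x; rewrite ?(negPf xs).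
Qed.

Lemma ternary_widen d k (s : seq nat) : all (gtn d) s ->
  ternary (d + k) (mem s) = ternary d (mem s).
Proof.
move=> sd; rewrite /ternary big_split_ord /= [X in _ + X]big1 ?addn0 // => i _.
suff /negPf-> : d + i \notin s by [].
by apply/negP => /(allP sd) /=; rewrite ltnNge leq_addr.
Qed.

Definition instr_ok (K d0 : nat) (c : instr) : bool :=
  match c with
  | INC r | DEC r => r < K
  | JZ r t => (r < K) && (t < d0)
  | JMP t => t < d0
  end.

Lemma instr_safe_ok K d0 c : instr_safe K d0 c -> instr_ok K d0 c.
Proof. by case: c => [r|r|r t|t] /=; lia. Qed.

Section Presentation.
Variables (K : nat) (prog : seq instr).
Hypothesis K2 : 1 < K.
Hypothesis prog_ok : all (instr_ok K (core_dim K prog)) prog.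
Let d0 := core_dim K prog.

(** The number, in dimension [d0], of the machine move on the face with number [A]. *)
Definition core_entry A :=
  let m := sim K prog 0 (bit A) in
  \sum_(i < d0) (1 + (val i \in m.1) - (val i \in m.2)) * 3 ^ i.

(** This number is both the input of the program and the data from which the code of
the instance is computed. *)
Definition table := CodeSeq.code (d0 :: [seq core_entry A | A <- iota 0 (2 ^ d0)]).
Local Notation s := table.
Let d := d0 + s.
Local Notation simd := (sim K prog s).

Lemma code_head_table : code_head s = d0.
Proof. exact: code_head_cons. Qed.

Lemma d_gt0 : 0 < d. Proof. by []. Qed.

(** Extra positions do not affect the moves on faces where none of them is active. *)
Lemma sim_core A : 0 < A < 2 ^ d0 -> simd (bit A) = sim K prog 0 (bit A).
Proof.
move=> /andP[A0 Ad0].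
have Ad : A < 2 ^ d by rewrite (leq_trans Ad0) // leq_exp2l // leq_addr.
have hd0 : has (bit A) (iota 0 d0) by rewrite has_bit // -lt0n.
have hd : has (bit A) (iota 0 d) by rewrite has_bit // -lt0n.
rewrite /sim -/d0 -/d addn0 hd hd0 /=.
suff -> : top d (bit A) = top d0 (bit A) by [].
have [j1 j2 j3] := topP hd0.
apply: topE => //; first by rewrite (leq_trans j1) ?leq_addr.
move=> i id bi; apply: j3 => //; rewrite ltnNge; apply/negP => di.
by rewrite (bit_ge Ad0 di) in bi.
Qed.

Lemma instr_at_ok j : j < d0 -> instr_ok K d0 (instr_at K prog j).
Proof.
move=> jd; rewrite /instr_at -/d0 jd.
have ok1 : instr_ok K d0 (JMP 1) by rewrite /= /d0 /core_dim; lia.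
case: (j - K) => [|i] //=.
have /(all_nthP (JMP 1)) ok := prog_ok.
have [lt|ge] := ltnP i (size prog); first exact: ok.
by rewrite nth_default.
Qed.

Lemma sim_core_lt A : 0 < A < 2 ^ d0 ->
  all (gtn d0) (sim K prog 0 (bit A)).1 /\ all (gtn d0) (sim K prog 0 (bit A)).2.
Proof.
move=> /andP[A0 Ad0].
have hd0 : has (bit A) (iota 0 d0) by rewrite has_bit // -lt0n.
rewrite /sim -/d0 addn0 hd0 /=; have [jd _ _] := topP hd0.
have Kd : K < d0 by rewrite /d0 /core_dim; lia.
case: ifP => [jK|jK]; first by rewrite /= jd.
by case: (instr_at _ _ _) (instr_at_ok jd) => [r|r|r t|t] /= ok; try case: ifP => _ /=; lia.
Qed.

Lemma is_sim_numberE A B : A < 2 ^ d -> B < 3 ^ d ->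
  (nth_move d B == sim_move (nth_face d A)) = is_sim_number s A B.
Proof.
move=> Ad Bd; rewrite /sim_move -/d0 -/d nth_move_mkmove // active_nth_face //.
rewrite /is_sim_number code_head_table -/d0 -/d.
have hd := has_bit Ad.
case: eqP hd => [->|/eqP A0] hd.
  have dp : d.-1 < d by rewrite ltn_predL d_gt0.
  rewrite /sim -/d0 -/d hd /= (ternary_mem (s := [:: d.-1])) //; last by apply/andP.
  by rewrite big_seq1 /ternary big1 // addn0.
have A0' : 0 < A by rewrite lt0n.
have [Ad0|Ad0] := ltnP A (2 ^ d0).
  have A0d : 0 < A < 2 ^ d0 by rewrite A0'.
  rewrite sim_core //.
  have [u0 v0] := sim_core_lt A0d.
  have -> : code_nth s A.+1 = core_entry A.
    by rewrite /table code_nthE /= (nth_map 0) ?size_iota // nth_iota.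
  have E : core_entry A + ternary d0 (mem (sim K prog 0 (bit A)).2)
      = ones d0 + ternary d0 (mem (sim K prog 0 (bit A)).1).
    rewrite /core_entry /ternary /ones -!big_split; apply: eq_bigr => i _ /=.
    by do 2!case: (_ \in _) => /=; lia.
  rewrite !ternary_widen //; apply/eqP/eqP; lia.
rewrite /topb.
have hd1 : has (bit A) (iota 0 d) by rewrite hd.
have [jd bj ji] := topP hd1; set j := top d (bit A) in jd bj ji *.
have d0j : d0 <= j.
  rewrite leqNgt; apply/negP => jd0; move: Ad0; rewrite leqNgt => /negP; apply.
  rewrite -(modn_small Ad) -bit_sum /d big_split_ord /= [X in _ + X]big1 ?addn0.
    by rewrite bit_sum ltn_pmod // expn_gt0.
  move=> i _; case bi: (bit A _) => //.
  have := ji (d0 + i); rewrite bi ltn_add2l ltn_ord => /(_ isT isT); lia.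
have dK : K + 1 <= d0 by rewrite /d0 /core_dim; lia.
have -> : simd (bit A) = ([:: j.-1; 0], [:: j]).
  rewrite /sim -/d0 -/d hd1 -/j /= /instr_at -/d0.
  by rewrite [j < K]ltnNge [j < d0]ltnNge d0j (leq_trans _ d0j) //; lia.
have dd : all (gtn d) [:: j] by apply/andP.
have du : all (gtn d) [:: j.-1; 0].
  by apply/and3P; split=> //; apply: leq_ltn_trans (leq_pred j) jd.
have uu : uniq [:: j.-1; 0] by rewrite /= inE; lia.
by rewrite (ternary_mem (s := [:: j])) // (ternary_mem uu du) !big_cons !big_nil expn0 !addn0.
Qed.

Lemma is_drain_numberE A B : A < 2 ^ d -> B < 3 ^ d ->
  (nth_move d B == drain_move (nth_face d A)) = is_drain_number s A B.
Proof.
move=> Ad Bd; rewrite /drain_move -/d0 -/d nth_move_mkmove // active_nth_face //.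
by rewrite /is_drain_number code_head_table -/d0 -/d [ternary d pred0]big1 // addn0.
Qed.

Lemma encode_prob A B : A < 2 ^ d -> B < 3 ^ d ->
  encode_rat (machine_prob K prog s (nth_face d A, nth_move d B)) =
  [:: 0; entry_num s A B; entry_den s A B].
Proof.
move=> Ad Bd; rewrite ffunE /= is_sim_numberE // is_drain_numberE // /entry_num /entry_den.
by case: (is_sim_number s A B); case: (is_drain_number s A B).
Qed.

(** The self-reference: with [s] the code of the table of a program, the walk of the
program on input [s] has a code that is computed from [s]. *)
Lemma encode_machine : encode (machine K prog s) = instance_code s.
Proof.
rewrite /encode /instance_code code_head_table -/d0 -/d /instance_data -[Defs.dim (machine
    K prog s)]/d.
congr (CodeSeq.code (d :: (_ ++ _))).
  have ap T (f : nat -> nat -> T) a b :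
      [seq f x y | x <- iota 0 a, y <- iota 0 b] =
      mkseq (fun i => f (i %/ b) (i %% b)) (a * b).
    by rewrite -flatten_mkseq.
  rewrite ap.
  pose g k i := nth 0 (encode_rat (prob (machine K prog s)
    (nth_face d (k %/ 3 ^ d), nth_move d (k %% 3 ^ d)))) i.
  have -> N : mkseq (fun k => encode_rat (prob (machine K prog s)
      (nth_face d (k %/ 3 ^ d), nth_move d (k %% 3 ^ d)))) N = [seq mkseq (g k) 3 | k <-
          iota 0 N] by [].
  rewrite flatten_mkseq mulnC.
  apply/eq_in_map => i; rewrite mem_iota add0n /= => lt.
  have ik : i %/ 3 < 2 ^ d * 3 ^ d by rewrite ltn_divLR // mulnC.
  rewrite /g encode_prob ?ltn_pmod ?expn_gt0 ?ltn_divLR ?expn_gt0 //; last by rewrite mulnC.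
  rewrite /prob_entry code_head_table -/d0 -/d.
  have := ltn_pmod i (d := 3) isT; case: (i %% 3) => [|[|[|]]] //.
rewrite catA; congr cat; last first.
  rewrite -val_enum_ord -[RHS]map_comp.
  have E (i : 'I_d) : dir (machine K prog s) i = nat_of_bool (val i == 1) by rewrite ffunE.
  exact: (eq_map E).
have -> : [seq nat_of_bool (0 < i %% 3) | i <- iota 0 (3 * d.+1)] =
    flatten [seq [:: 0; 1; 1] | k <- iota 0 d.+1].
  by rewrite mulnC; exact: esym (flatten_mkseq (fun _ i => nat_of_bool (0 < i)) d.+1 3).
have -> : iota 0 d.+1 = iota 0 d ++ [:: d] by rewrite -[d.+1]addn1 iotaD.
rewrite map_cat flatten_cat; congr (_ ++ _).
rewrite -val_enum_ord -[in RHS]map_comp.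
have E (i : 'I_d) : encode_rat (weight (machine K prog s) i) = [:: 0; 1; 1] by rewrite ffunE.
by congr flatten; exact: (eq_map E).
Qed.
End Presentation.

(** * The diagonal instance *)

(** At the test the configuration recurs after two steps, the jump back included. *)
Lemma failed_test_rate (R : realType) K c1 r c3 k u :
  let c0 := Seq c1 (Seq (While r Skip) c3) in
  1 < K -> all_regs (fun r => (r < K) && (r != 1)) c0 ->
  exec c1 (upd (fun=> 0) 0 k) u -> u r != 0 ->
  ~ L_minus_le_rate R (machine K (flatten_cmd c0 K) k) /\
  ~ L_plus_le_rate R (machine K (flatten_cmd c0 K) k).
Proof.
move=> c0 K2 regs ex ur.
have d0E := d0E K c0; set e := K + cmd_size c3.
have /andP[regs1 /andP[/andP[/andP[rK _] _] _]] := regs.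
have [code2 code1] := code_at_cat (@code_at_prog K c0 k :
  code_at K c0 K (flatten_cmd (Seq (While r Skip) c3) K ++ flatten_cmd c1 (K + (2 +
      cmd_size c3)))).
have [_ code_loop] := code_at_cat (code2 :
  code_at K c0 K (flatten_cmd c3 K ++ flatten_cmd (While r Skip) e)).
rewrite !size_flatten_cmd /= -?/e in code1 code_loop.
have dE : K + cmd_size c0 = e.+2 + cmd_size c1 by rewrite /e /c0 /=; lia.
have Jmp : instr_at K (flatten_cmd c0 K) e.+1 = JMP e.+2.
  by have := code_loop 0 isT; rewrite addn0 /= addn0.
have Jz : instr_at K (flatten_cmd c0 K) e.+2 = JZ r e.
  have <- : e.+1 + 1 = e.+2 by rewrite addn1.
  exact: (code_loop 1 isT).
have [||||n E] := @simulation K c0 k c1 e.+2 _ _ ex.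
- by apply: all_regsW regs1 => q /andP[].
- by rewrite /e; lia.
- by rewrite d0E dE; lia.
- have -> : e.+2 = K + (2 + cmd_size c3) by rewrite /e; lia.
  exact: code1.
apply: (@looping_rate K c0 k K2 regs (n + k.+1) e.+2 u).
- by rewrite /e; lia.
- by rewrite d0E dE; lia.
- by rewrite iterD (@load_end K c0 k K2) dE.
rewrite (step_jz _ _ _ rK _ Jz) ?(negPf ur) ?d0E ?dE /=; try (rewrite /e; lia).
by rewrite (step_jmp _ _ _ _ Jmp) // ?d0E ?dE /=; rewrite /e; lia.
Qed.

(** The program applies [f] to the code of its own instance.  If the answer is 0 it
empties its registers and halts; otherwise it loops. *)
Lemma diagonal_instance (R : realType) (f : recfun 1) : exists I : instance,
  [/\ valid_instance R I,
      computes f [tuple encode I] 0 -> L_minus_le_rate R I /\ L_plus_le_rate R I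
    & computes f [tuple encode I] 1 -> ~ L_minus_le_rate R I /\ ~ L_plus_le_rate R I].
Proof.
have [h hE] := rec1_instance_code.
(* The input is loaded into register 0 and register 1 signals halting, so the output
   goes to register 2 and the scratch space starts at 3. *)
pose c1 := compile (RComp f (fun _ : 'I_1 => h)) [:: 0] 2 3.
pose c0 := Seq c1 (Seq (While 2 Skip) (clear 0)).
have regs1 : all_regs (fun r => r != 1) c0.
  have regs_c1 : all_regs (fun r => r != 1) c1 by apply: all_regs_compile => // r; lia.
  by rewrite -[all_regs _ c0]/(all_regs (fun r => r != 1) c1 && true) regs_c1.
have [K1 regsK] := all_regs_bound c0.
pose K := maxn 2 K1; have K2 : 1 < K by rewrite /K; lia.
have regs : all_regs (fun r => (r < K) && (r != 1)) c0.
  rewrite all_regsI regs1 andbT; apply: all_regsW regsK => r /=; rewrite /K; lia.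
have prog_ok : all (instr_ok K (core_dim K (flatten_cmd c0 K))) (flatten_cmd c0 K).
  have safe : all (instr_safe K (core_dim K (flatten_cmd c0 K))) (flatten_cmd c0 K).
    by apply: flatten_cmd_safe => //; rewrite /core_dim size_flatten_cmd.
  by move: safe; apply: sub_all => c; apply: instr_safe_ok.
pose s := table K (flatten_cmd c0 K).
have encI : encode (machine K (flatten_cmd c0 K) s) = instance_code s := encode_machine K2
    prog_ok.
have run y : computes f [tuple instance_code s] y ->
    exec c1 (upd (fun=> 0) 0 s) (upd (upd (fun=> 0) 0 s) 2 y).
  move=> fy; apply: (@compile_correct 1 _ [tuple s]) => //.
  - exists [tuple instance_code s] => // i.
    have := hE [tuple s]; rewrite (tnth_nth 0) /=; by case: i => -[].
  - by move=> r r3; rewrite /upd; case: eqP => //; lia.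
exists (machine K (flatten_cmd c0 K) s); rewrite encI; split.
- exact: machine_valid.
- move=> /run ex; apply: (@halting_rate K c0 s K2 regs R (upd (upd (upd (fun=> 0) 0 s) 2 0)
    0 0)).
    apply: ExecSeq ex _; apply: ExecSeq (exec_clear _ _).
    exact: ExecDone.
  by move=> r; rewrite /upd; do 2?case: eqP.
by move=> /run ex; apply: failed_test_rate ex _.
Qed.

Theorem theorem3 (R : realType) :
  ~ decidable_on encode (valid_instance R) (L_minus_le_rate R) /\
  ~ decidable_on encode (valid_instance R) (L_plus_le_rate R).
Proof.
split=> -[f fP]; have [I [valid halts loops]] := diagonal_instance R f.
  have [f1 f0] := fP I valid.
  have [L|nL] := pselect (L_minus_le_rate R I).
    by have [nL _] := loops (f1 L); apply: nL.
  by have [L _] := halts (f0 nL); apply: nL.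
have [f1 f0] := fP I valid.
have [L|nL] := pselect (L_plus_le_rate R I).
  by have [_ nL] := loops (f1 L); apply: nL.
by have [_ L] := halts (f0 nL); apply: nL.
Qed.
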